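(* Let $f(\mathbf x)$ be a multi-form of even degree $d_i=2\tau_i$ with respect to $\mathbf x^{(i)}\in\mathbb R^{n_i}$, $i=1,\dots,p$, and let $g(\mathbf x):=\prod_{i=1}^p\|\mathbf x^{(i)}\|^{d_i}$. For $\eta=(\eta_1,\dots,\eta_p)\in\mathbb N^p$ let $\gamma_\eta$ be the optimal value of $$\gamma_\eta:=\max\bigg\{\gamma\in\mathbb R : \prod_{i=1}^p(\mathbf e^{\mathsf T}\mathbf x^{(i)})^{2\eta_i}\,\big(f(\mathbf x)-\gamma g(\mathbf x)\big)\in\Sigma^+_{\mathbf d+2\eta,n_1,\dots,n_p}\bigg\}.$$ Then $$f_{\mathrm{dnn}}\le\gamma_\eta\le f_{\min},\qquad\text{and}\qquad \gamma_\eta\le\gamma_{\overline\eta}\ \text{ whenever }\eta\le\overline\eta\ \text{(componentwise)},$$ and $$\gamma_\eta\to f_{\min}\quad\text{as}\quad \min\{\eta_i : i=1,\dots,p\}\to\infty.$$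
   Context: Here $p,n_1,\dots,n_p$ are positive integers, $\tau_1,\dots,\tau_p$ are nonnegative integers, $\mathbb N=\{0,1,2,\dots\}$, $\tau=(\tau_1,\dots,\tau_p)$, $\mathbf d=2\tau$, $\mathbf x=(\mathbf x^{(1)},\dots,\mathbf x^{(p)})$, $\|\cdot\|$ is the Euclidean norm and $\mathbf e$ is the all-ones vector. A multi-form of degree $d_i$ in each $\mathbf x^{(i)}$ is a real polynomial all of whose monomials have degree exactly $d_i$ in the group $\mathbf x^{(i)}$ for every $i$; $\mathbb R[\mathbf x]_{\mathbf d}$ is the set of these. $f_{\min}$ is the minimum of $f(\mathbf x^{(1)},\dots,\mathbf x^{(p)})$ subject to $\prod_{i=1}^p\|\mathbf x^{(i)}\|^{d_i}=1$ and $\mathbf x^{(i)}\in\mathbb R^{n_i}$, $\mathbf x^{(i)}\ge\mathbf 0$ for all $i$ (equivalently, subject to $\|\mathbf x^{(i)}\|=1$, $\mathbf x^{(i)}\ge\mathbf 0$ for all $i$). For $s=(s_1,\dots,s_p)\in\mathbb N^p$, $\mathbf x^{[s]}:=(\mathbf x^{(1)})^{[s_1]}\otimes\dots\otimes(\mathbf x^{(p)})^{[s_p]}$, where $(\mathbf x^{(i)})^{[s_i]}$ is the vector of all monomials of degree $s_i$ in the $n_i$ variables $\mathbf x^{(i)}$ (lexicographically ordered). So $\mathbf x^{[s]}$ is the vector of all monomials of multidegree $s$. For $s\in\mathbb N^p$, $$\Sigma^+_{2s,n_1,\dots,n_p}:=\{h\in\mathbb R[\mathbf x]_{2s} : h(\mathbf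 x)=(\mathbf x^{[s]})^{\mathsf T}(S+T)\,\mathbf x^{[s]}\text{ for some symmetric } S\succeq\mathbf 0\text{ and some matrix }T\ge\mathbf 0\},$$ where $S\succeq\mathbf 0$ means positive semidefinite and $T\ge\mathbf 0$ means entrywise nonnegative. Write $\mathbb N^n_m:=\{\gamma\in\mathbb N^n:\gamma_1+\dots+\gamma_n=m\}$ and $I_{\mathbf d}:=\mathbb N^{n_1}_{d_1}\times\dots\times\mathbb N^{n_p}_{d_p}$. The matrices $A_\alpha$, $\alpha\in I_{\mathbf d}$, are defined by $\mathbf x^{[\tau]}(\mathbf x^{[\tau]})^{\mathsf T}=\sum_{\alpha\in I_{\mathbf d}}A_\alpha\mathbf x^\alpha$, and $M(\mathbf y):=\sum_{\alpha\in I_{\mathbf d}}A_\alpha y_\alpha$ for a real vector $\mathbf y=(y_\alpha)_{\alpha\in I_{\mathbf d}}$. Let $\mathbf f,\mathbf g$ be the coefficient vectors of $f,g$ in the monomial basis $\mathbf x^{[\mathbf d]}$. Then $f_{\mathrm{dnn}}$ is the optimal value of the doubly nonnegative (DNN) relaxation $$f_{\mathrm{dnn}}:=\min\{\langle\mathbf f,\mathbf y\rangle : M(\mathbf y)\succeq\mathbf 0,\ M(\mathbf y)\ge\mathbf 0,\ \langle\mathbf g,\mathbf y\rangle=1\}.$$ *)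

(* Defs.v *)
From HB Require Import structures.
From mathcomp Require Import all_boot all_order all_algebra.
From mathcomp Require Import mpoly.
From mathcomp Require Import boolp classical_sets reals.

Set Implicit Arguments.
Unset Strict Implicit.
Unset Printing Implicit Defensive.

Import Order.TTheory GRing.Theory Num.Theory.

Local Open Scope classical_set_scope.
Local Open Scope ring_scope.

(* The entry j of the block x^(i), for i : 'I_p and j : 'I_(n i), is the
   variable of index tagnat.Rank i j; the index k belongs to the block
   tagnat.sig1 k and is at position tagnat.sig2 k in it, as for \mxrow. *)
Notation nvars n := (\sum_i n i)%N.
Notation mvpoly R n := {mpoly R[nvars n]}.

Definition xvar (R : realType) (p : nat) (n : 'I_p -> nat)
    (i : 'I_p) (j : 'I_(n i)) : mvpoly R n :=
  'X_(tagnat.Rank i j).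
Arguments xvar R {p} n i j.

Definition eval_blocks (R : realType) (p : nat) (n : 'I_p -> nat)
    (f : mvpoly R n) (x : forall i, 'cV[R]_(n i)) : R :=
  f.@[fun k => x (tagnat.sig1 k) (tagnat.sig2 k) 0].

Definition blockdeg (p : nat) (n : 'I_p -> nat) (m : 'X_{1..(nvars n)})
    (i : 'I_p) : nat :=
  (\sum_(j < n i) m (tagnat.Rank i j))%N.

Definition has_multideg (p : nat) (n : 'I_p -> nat) (s : 'I_p -> nat)
    (m : 'X_{1..(nvars n)}) : bool :=
  [forall i, blockdeg m i == s i].

Definition multiform (R : realType) (p : nat) (n : 'I_p -> nat)
    (d : 'I_p -> nat) (f : mvpoly R n) : Prop :=
  {in msupp f, forall m, has_multideg d m}.

Definition enorm (R : realType) (k : nat) (v : 'cV[R]_k) : R :=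
  Num.sqrt (\sum_j v j 0 ^+ 2).

Definition nonneg_mx (R : realType) (k l : nat) (A : 'M[R]_(k, l)) : Prop :=
  forall i j, 0 <= A i j.

Definition psd_mx (R : realType) (k : nat) (A : 'M[R]_k) : Prop :=
  A^T = A /\ forall v : 'cV[R]_k, 0 <= (v^T *m A *m v) 0 0.

(* The multi-indices of multidegree s.  Multinomials are ordered by total
   degree and then lexicographically on exponents; all the members of this list
   have total degree \sum_i s i, so that sorting with >=%O lists the monomials
   lexicographically, x_1 being the largest variable.  This is the order of
   the tensor product of the lexicographically ordered blocks. *)
Definition multidegs (p : nat) (n : 'I_p -> nat) (s : 'I_p -> nat) :
    seq 'X_{1..(nvars n)} :=
  sort >=%O
    [seq m <- [seq bmnm b | b : 'X_{1..(nvars n) < (\sum_i s i).+1}]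
       | has_multideg s m].
Arguments multidegs {p} n s.

Notation nmultidegs n s := (size (multidegs n s)).

Definition multideg_nth (p : nat) (n : 'I_p -> nat) (s : 'I_p -> nat)
    (k : 'I_(nmultidegs n s)) : 'X_{1..(nvars n)} :=
  tnth (in_tuple (multidegs n s)) k.

Definition monomials (R : realType) (p : nat) (n : 'I_p -> nat)
    (s : 'I_p -> nat) : 'cV[mvpoly R n]_(nmultidegs n s) :=
  \col_k 'X_[multideg_nth k].
Arguments monomials R {p} n s.

Definition twice (p : nat) (s : 'I_p -> nat) : 'I_p -> nat :=
  fun i => (2 * s i)%N.

(* The cone of index 2s. *)
Definition SigmaPlus (R : realType) (p : nat) (n : 'I_p -> nat)
    (s : 'I_p -> nat) (h : mvpoly R n) : Prop :=
  multiform (twice s) h /\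
  exists S T : 'M[R]_(nmultidegs n s),
    [/\ psd_mx S, nonneg_mx T &
        h = ((monomials R n s)^T *m map_mx (@mpolyC (nvars n) R) (S + T)
               *m monomials R n s) 0 0].

(* \prod_i ||x^(i)||^(2 tau_i), see eval_gpoly. *)
Definition gpoly (R : realType) (p : nat) (n : 'I_p -> nat)
    (tau : 'I_p -> nat) : mvpoly R n :=
  \prod_i (\sum_(j < n i) xvar R n i j ^+ 2) ^+ tau i.
Arguments gpoly R {p} n tau.

(* inf and sup take a default value on sets where they do not exist, so an
   optimal value below is only meaningful together with is_minimum or
   is_maximum, which also express that the optimum is attained. *)
Definition is_minimum (R : realType) (A : set R) (v : R) : Prop :=
  A v /\ lbound A v.

Definition is_maximum (R : realType) (A : set R) (v : R) : Prop :=
  A v /\ ubound A v.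

Definition fmin_values (R : realType) (p : nat) (n : 'I_p -> nat)
    (tau : 'I_p -> nat) (f : mvpoly R n) : set R :=
  [set eval_blocks f x | x in
    [set x : forall i, 'cV[R]_(n i) |
      \prod_i enorm (x i) ^+ twice tau i = 1 /\
      forall i, nonneg_mx (x i)]].

Definition f_min (R : realType) (p : nat) (n : 'I_p -> nat)
    (tau : 'I_p -> nat) (f : mvpoly R n) : R :=
  inf (fmin_values tau f).

Definition gamma_values (R : realType) (p : nat) (n : 'I_p -> nat)
    (tau eta : 'I_p -> nat) (f : mvpoly R n) : set R :=
  [set c : R |
    SigmaPlus (fun i => tau i + eta i)%N
      (\prod_i (\sum_(j < n i) xvar R n i j) ^+ twice eta i
         * (f - c *: gpoly R n tau))].

Definition gamma_opt (R : realType) (p : nat) (n : 'I_p -> nat)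
    (tau eta : 'I_p -> nat) (f : mvpoly R n) : R :=
  sup (gamma_values tau eta f).

Definition coef_vec (R : realType) (p : nat) (n : 'I_p -> nat)
    (d : 'I_p -> nat) (f : mvpoly R n) : 'cV[R]_(nmultidegs n d) :=
  \col_k f@_(multideg_nth k).

(* The coefficient of x^alpha in x^[tau] (x^[tau])^T, see monomials_outerE. *)
Definition coef_mx (R : realType) (p : nat) (n : 'I_p -> nat)
    (tau : 'I_p -> nat) (alpha : 'X_{1..(nvars n)}) :
    'M[R]_(nmultidegs n tau) :=
  map_mx (mcoeff alpha) (monomials R n tau *m (monomials R n tau)^T).
Arguments coef_mx R {p n} tau alpha.

Definition moment_mx (R : realType) (p : nat) (n : 'I_p -> nat)
    (tau : 'I_p -> nat) (y : 'cV[R]_(nmultidegs n (twice tau))) :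
    'M[R]_(nmultidegs n tau) :=
  \sum_k y k 0 *: coef_mx R tau (multideg_nth k).

Definition fdnn_values (R : realType) (p : nat) (n : 'I_p -> nat)
    (tau : 'I_p -> nat) (f : mvpoly R n) : set R :=
  [set ((coef_vec (twice tau) f)^T *m y) 0 0 | y in
    [set y : 'cV[R]_(nmultidegs n (twice tau)) |
      [/\ psd_mx (moment_mx y), nonneg_mx (moment_mx y) &
          ((coef_vec (twice tau) (gpoly R n tau))^T *m y) 0 0 = 1]]].

Definition f_dnn (R : realType) (p : nat) (n : 'I_p -> nat)
    (tau : 'I_p -> nat) (f : mvpoly R n) : R :=
  inf (fdnn_values tau f).

Lemma mdeg_blockdeg (p : nat) (n : 'I_p -> nat) (m : 'X_{1..(nvars n)}) :
  mdeg m = (\sum_i blockdeg m i)%N.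
Proof.
rewrite mdegE (sig_big_dep xpredT (fun _ => xpredT)
  (fun i (j : 'I_(n i)) => m (tagnat.Rank i j))) /=.
rewrite (reindex (@tagnat.rank p n)) /=; last first.
  by apply: onW_bij; exact: tagnat.rank_bij.
by apply: eq_bigr => -[i j] _.
Qed.

Lemma mem_multidegs (p : nat) (n : 'I_p -> nat) (s : 'I_p -> nat)
    (m : 'X_{1..(nvars n)}) :
  (m \in multidegs n s) = has_multideg s m.
Proof.
rewrite mem_sort mem_filter andbC; apply: andb_idl => ms.
have lt_m : (mdeg m < (\sum_i s i).+1)%N.
  rewrite ltnS mdeg_blockdeg leq_sum // => i _.
  by move/forallP: ms => /(_ i) /eqP ->.
by apply/mapP; exists (BMultinom lt_m); rewrite ?mem_enum.
Qed.

Lemma multidegs_uniq (p : nat) (n : 'I_p -> nat) (s : 'I_p -> nat) :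
  uniq (multidegs n s).
Proof.
by rewrite sort_uniq filter_uniq // map_inj_uniq ?enum_uniq //; exact: val_inj.
Qed.

Lemma eval_xvar (R : realType) (p : nat) (n : 'I_p -> nat)
    (x : forall i, 'cV[R]_(n i)) (i : 'I_p) (j : 'I_(n i)) :
  eval_blocks (xvar R n i j) x = x i j 0.
Proof.
rewrite /eval_blocks /xvar mevalXU.
pose c (u : {i : 'I_p & 'I_(n i)}) := x (tag u) (tagged u) 0.
by rewrite -[LHS]/(c (tagnat.sig _)) tagnat.rankK.
Qed.

Lemma eval_gpoly (R : realType) (p : nat) (n : 'I_p -> nat)
    (tau : 'I_p -> nat) (x : forall i, 'cV[R]_(n i)) :
  eval_blocks (gpoly R n tau) x = \prod_i enorm (x i) ^+ twice tau i.
Proof.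
rewrite /eval_blocks rmorph_prod; apply: eq_bigr => i _.
rewrite rmorphXn raddf_sum /= exprM sqr_sqrtr; last first.
  by apply: sumr_ge0 => j _; rewrite sqr_ge0.
congr (_ ^+ _); apply: eq_bigr => j _.
by rewrite rmorphXn /= -/(eval_blocks _ x) eval_xvar.
Qed.

Lemma monomials_outerE (R : realType) (p : nat) (n : 'I_p -> nat)
    (tau : 'I_p -> nat) :
  monomials R n tau *m (monomials R n tau)^T =
  \sum_(k < nmultidegs n (twice tau))
    map_mx (fun c : R => c *: 'X_[multideg_nth k])
           (coef_mx R tau (multideg_nth k)).
Proof.
apply/matrixP => i j; rewrite summxE.
set h := (_ *m _) i j.
rewrite [RHS](eq_bigr (fun k : 'I_(nmultidegs n (twice tau)) =>
    h@_(multideg_nth k) *: 'X_[multideg_nth k])); last first.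
  by move=> k _; rewrite [LHS]mxE [X in X *: _]mxE.
have hE : h = 'X_[multideg_nth i + multideg_nth j].
  by rewrite /h !mxE big_ord1 !mxE mpolyXD.
set m := (multideg_nth i + multideg_nth j)%MM in hE.
have mE : m \in multidegs n (twice tau).
  rewrite mem_multidegs; apply/forallP => l; apply/eqP.
  have mi (k : 'I_(nmultidegs n tau)) : blockdeg (multideg_nth k) l = tau l.
    have : multideg_nth k \in multidegs n tau by exact: mem_tnth.
    by rewrite mem_multidegs => /forallP /(_ l) /eqP.
  rewrite /twice mul2n -addnn -{1}(mi i) -(mi j) /blockdeg -big_split /=.
  by apply: eq_bigr => k _; rewrite mnmDE.
have [k0 mk0] : exists k0 : 'I_(nmultidegs n (twice tau)), m = multideg_nth k0.
  by have /tnthP [k0 ->] : m \in in_tuple (multidegs n (twice tau)) by []; exists k0.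
rewrite (bigD1 k0) //= [X in _ + X]big1 => [|k ne_k]; rewrite hE !mcoeffX mk0.
  by rewrite eqxx scale1r [RHS]addr0.
have ne : (multideg_nth k0 == multideg_nth k) = false.
  have /tuple_uniqP inj : uniq (in_tuple (multidegs n (twice tau))).
    exact: multidegs_uniq.
  by rewrite (inj_eq inj) eq_sym (negbTE ne_k).
by rewrite ne scale0r.
Qed.

(* Main.v *)
Require Import Defs.
From HB Require Import structures.
From mathcomp Require Import all_boot all_order all_algebra.
From mathcomp Require Import mpoly.
From mathcomp Require Import boolp classical_sets reals.
From mathcomp Require Import topology normedtype.
From mathcomp Require derive.
From mathcomp Require Import ring lra.

Set Implicit Arguments.
Unset Strict Implicit.
Unset Printing Implicit Defensive.

Import Order.TTheory GRing.Theory Num.Theory.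
Import numFieldNormedType.Exports.

Local Open Scope classical_set_scope.
Local Open Scope ring_scope.

(** Everything rests on conic duality for the cone of forms
[x^[s]^T (S + T) x^[s]].  The dual object is a linear functional on polynomials
that is nonnegative on squares of forms of multidegree [s] and on products of
two monomials of multidegree [s] ([dnn_functional]); on forms of multidegree
[2s] this says that the moment matrix of the functional is positive
semidefinite and entrywise nonnegative.  A form of multidegree [2s] lies in the
cone if and only if all these functionals are nonnegative on it.  One direction
is the self-duality of the semidefinite cone ([SigmaPlus_dnn]).  For the other
([dnn_SigmaPlus]), a form outside the cone is separated from it by the residual
at a nearest point.  The nearest point exists because pairs [(S, T)] of bounded
forms are bounded ([gram_bounded]): the sum of the values of the form on a finite
grid of positive points is nonnegative on each summand, and the grid is fine
enough for these values to determine the coefficients.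

Duality turns membership of [gamma] in the set defining [gamma_eta] into a system
of linear inequalities in [gamma] ([gamma_valuesP]), so that the supremum is
attained.  Evaluation at a nonnegative point is one of the functionals, which
gives the upper bound by the minimum of [f].  If [L] is a form with nonnegative
coefficients and [l] is doubly nonnegative for the multidegree [t + s], [t] the
multidegree of [L], then [l (L ^ 2 * _)] is doubly nonnegative for [s]; with [L] a
product of powers of the sums of the blocks this gives the monotonicity in [eta],
and, by homogeneity of the relaxation ([fdnn_le]), the lower bound.

For the convergence, [f - c g] is bounded below by a positive constant on the
product of the simplices for every [c] below the minimum, and Polya's theorem
([polya]) makes all its coefficients nonnegative after multiplication by high
powers of the sums of the blocks; such a form is in the cone.  Polya's theorem is
proved by computing these coefficients ([polya_coef]): up to positive factors they
are values of the form on the product of simplices, with the powers replaced by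
falling factorials. *)

(** * Minima over compact sets of row vectors *)

Lemma continuous_sum_rV (R : realType) (n : nat) (I : Type) (r : seq I)
    (F : I -> 'rV[R]_n -> R) :
  (forall i, continuous (F i)) ->
  continuous (fun v => \sum_(i <- r) F i v).
Proof.
move=> cF; elim: r => [|i r IH].
  by under eq_fun do rewrite big_nil; exact: cst_continuous.
under eq_fun do rewrite big_cons.
by move=> v; apply: continuousD; [exact: cF | exact: IH].
Qed.

Lemma continuous_linear_rV (R : realType) (n : nat) (q : 'rV[R]_n -> R) :
  (forall a u v, q (a *: u + v) = a * q u + q v) -> continuous q.
Proof.
move=> q_lin.
have qD u v : q (u + v) = q u + q v by rewrite -[u]scale1r q_lin mul1r scale1r.
have q0 : q 0 = 0 by apply: (addrI (q 0)); rewrite -qD !addr0.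
have qZ a u : q (a *: u) = a * q u by rewrite -[a *: u]addr0 q_lin q0 addr0.
have -> : q = (fun v => \sum_j v 0 j * q (delta_mx 0 j)).
  apply: funext => v; rewrite {1}[v]row_sum_delta (big_morph q qD q0).
  by apply: eq_bigr => j _; rewrite qZ.
apply: continuous_sum_rV => j v.
by apply: continuousM; [exact: coord_continuous | exact: cst_continuous].
Qed.

Lemma continuous_meval (R : realType) (n : nat) (q : {mpoly R[n]}) :
  continuous (fun v : 'rV[R]_n => q.@[v 0]).
Proof.
have cX (m : 'X_{1..n}) (r : seq 'I_n) :
    continuous (fun v : 'rV[R]_n => \prod_(i <- r) v 0 i ^+ m i).
  elim: r => [|i r IH].
    by under eq_fun do rewrite big_nil; exact: cst_continuous.
  under eq_fun do rewrite big_cons.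
  move=> v.
  apply: (@continuousM R 'rV[R]_n (fun v => v 0 i ^+ m i)
            (fun v => \prod_(j <- r) v 0 j ^+ m j) v); last exact: IH.
  have vX : continuous (fun x : R => x ^+ m i).
    elim: (m i) => [|k IHk].
      by under eq_fun do rewrite expr0; exact: cst_continuous.
    under eq_fun do rewrite exprS.
    by move=> x; apply: (@continuousM R R id (fun y => y ^+ k) x) => //; exact: IHk.
  apply: (@continuous_comp _ _ _ (fun v : 'rV[R]_n => v 0 i)
            (fun x : R => x ^+ m i) v); last exact: vX.
  exact: coord_continuous.
under eq_fun do rewrite mevalE.
apply: continuous_sum_rV => m v.
by apply: continuousM; [exact: cst_continuous | exact: cX].
Qed.

(** The first hypothesis says that [A] is closed, in the form that is immediate to
check for a set defined by nonstrict inequalities between continuous functions. *)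
Lemma min_attained (R : realType) (n : nat) (A : set 'rV[R]_n)
    (f : 'rV[R]_n -> R) (B : R) :
  (forall v, (forall q : 'rV[R]_n -> R, continuous q -> (forall w, A w -> 0 <= q w) ->
                0 <= q v) -> A v) ->
  (forall v, A v -> forall j, `|v 0 j| <= B) ->
  A !=set0 -> continuous f ->
  exists2 v, A v & forall w, A w -> f v <= f w.
Proof.
move=> A_closed A_bounded A_neq0 f_cont.
have A_compact : compact A.
  pose box := [set v : 'rV[R]_n | forall i, [set` `[- B, B]] (v ord0 i)].
  have box_compact : compact box.
    exact: (@rV_compact R n (fun=> _) (fun=> @segment_compact R (- B) B)).
  have A_box : A `<=` box.
    by move=> v Av i; rewrite /= in_itv /= -ler_norml A_bounded.
  suff A_cl : closed A by exact: (subclosed_compact A_cl box_compact A_box).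
  have -> : A = \bigcap_(q in [set q : 'rV[R]_n -> R |
      continuous q /\ forall w, A w -> 0 <= q w]) [set v | 0 <= q v].
    apply/seteqP; split=> [v Av q [_]|v Av]; first exact.
    by apply: A_closed => q cq q_ge0; exact: (Av q).
  apply: closed_bigI => q [q_cont _].
  rewrite [X in closed X](_ : _ = q @^-1` [set x | 0 <= x]) //.
  by apply: closed_comp => [v _|]; [exact: q_cont | exact: closed_ge].
have f_within : {within A, continuous f} by exact: continuous_subspaceT.
have [v Av v_min] := derive.compact_EVT_min A_neq0 A_compact f_within.
by exists v => [|w Aw]; [exact/set_mem | apply: v_min; exact/mem_set].
Qed.

(** * Multidegrees and multi-forms *)

Section Blocks.

Variables (p : nat) (n : 'I_p -> nat).
Implicit Types (s t d : 'I_p -> nat) (m : 'X_{1..nvars n}) (i : 'I_p).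

Lemma blockdegD m1 m2 i :
  blockdeg (m1 + m2)%MM i = (blockdeg m1 i + blockdeg m2 i)%N.
Proof. by rewrite /blockdeg -big_split; apply: eq_bigr => j _; rewrite mnmDE. Qed.

Lemma blockdeg0 i : blockdeg (0%MM : 'X_{1..nvars n}) i = 0%N.
Proof. by apply: big1 => j _; rewrite mnm0E. Qed.

Lemma blockdeg1 i (j : 'I_(n i)) i' :
  blockdeg (U_(tagnat.Rank i j)%MM : 'X_{1..nvars n}) i' = (i == i').
Proof.
rewrite /blockdeg; have [eq_i|ne_i] := eqVneq i i'.
  rewrite -eq_i (bigD1 j) //= mnm1E eqxx big1 ?addn0 // => k ne_k.
  rewrite mnm1E; apply/eqP; rewrite eqb0.
  apply: contra_neq ne_k => /(congr1 (@tagnat.sig _ _)); rewrite !tagnat.rankK.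
  by move/eqP; rewrite eq_Tagged => /eqP /=.
apply: big1 => k _; rewrite mnm1E; apply/eqP; rewrite eqb0.
apply: contra_neq ne_i => /(congr1 (@tagnat.sig1 _ _)).
by rewrite !tagnat.Rank1K.
Qed.

Lemma has_multidegP s m : reflect (forall i, blockdeg m i = s i) (has_multideg s m).
Proof. by apply: (iffP forallP) => h i; apply/eqP; have := h i => // /eqP. Qed.

Lemma has_multidegD s t m1 m2 : has_multideg s m1 -> has_multideg t m2 ->
  has_multideg (fun i => s i + t i)%N (m1 + m2)%MM.
Proof.
move=> /has_multidegP s1 /has_multidegP t2; apply/has_multidegP => i.
by rewrite blockdegD s1 t2.
Qed.

Lemma eq_has_multideg s t : s =1 t -> has_multideg (n := n) s =1 has_multideg t.
Proof. by move=> st m; apply: eq_forallb => i; rewrite st. Qed.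

Lemma multidegs_nth s (k : 'I_(nmultidegs n s)) : has_multideg s (multideg_nth k).
Proof. by rewrite -mem_multidegs mem_tnth. Qed.

Lemma multideg_nthP s m :
  has_multideg s m -> exists k : 'I_(nmultidegs n s), m = multideg_nth k.
Proof.
rewrite -mem_multidegs => ms.
by have /tnthP[k ->] : m \in in_tuple (multidegs n s) by []; exists k.
Qed.

Lemma multideg_nth_inj s : injective (@multideg_nth p n s).
Proof.
have /tuple_uniqP // : uniq (in_tuple (multidegs n s)) by exact: multidegs_uniq.
Qed.

Lemma prod_blocks (R : comRingType) (F : 'I_(nvars n) -> R) :
  \prod_k F k = \prod_i \prod_(j < n i) F (tagnat.Rank i j).
Proof.
rewrite (sig_big_dep xpredT (fun _ => xpredT)
  (fun i (j : 'I_(n i)) => F (tagnat.Rank i j))) /=.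
rewrite (reindex (@tagnat.rank p n)) /=; last first.
  by apply: onW_bij; exact: tagnat.rank_bij.
by apply: eq_bigr => -[i j] _.
Qed.

(** Units are moved one at a time inside each block. *)
Lemma sub_multideg s m : (forall i, s i <= blockdeg m i)%N ->
  exists2 m', has_multideg s m' & (m' <= m)%MM.
Proof.
move=> le_sm.
have pick (q : nat) (a : 'I_q -> nat) k : (k <= \sum_j a j)%N ->
    exists2 b : 'I_q -> nat, (\sum_j b j)%N = k & forall j, (b j <= a j)%N.
  elim: k => [_|k IH lt_k]; first by exists (fun=> 0%N); rewrite ?big1.
  have [b sum_b le_ba] := IH (ltnW lt_k).
  have [j lt_j] : exists j, (b j < a j)%N.
    apply/existsP; apply: contraTT lt_k; rewrite negb_exists => /forallP ge_a.
    rewrite -leqNgt -sum_b leq_sum // => j _.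
    by rewrite leqNgt ge_a.
  exists (fun j' => b j' + (j' == j))%N => [|j'].
    rewrite big_split /= sum_b (bigD1 j) //= big1 => [|j' /negbTE -> //].
    by rewrite eqxx addn0 addn1.
  by case: eqVneq => [->|_]; rewrite ?addn1 ?addn0.
pose c i := cid2 (pick _ (fun j => m (tagnat.Rank i j)) _ (le_sm i)).
pose b i := s2val (c i).
have sum_b i : (\sum_j b i j)%N = s i by exact: (s2valP (c i)).
have le_b i j : (b i j <= m (tagnat.Rank i j))%N by exact: (s2valP' (c i)).
pose m' := [multinom b (tagnat.sig1 k) (tagnat.sig2 k) | k < nvars n].
have m'E i j : m' (tagnat.Rank i j) = b i j.
  rewrite mnmE; pose d (u : {i : 'I_p & 'I_(n i)}) := b (tag u) (tagged u).
  by rewrite -[LHS]/(d (tagnat.sig _)) tagnat.rankK.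
exists m'; first by apply/has_multidegP => i; rewrite -sum_b; apply: eq_bigr.
apply/mnm_lepP => k; rewrite mnmE; apply: leq_trans (le_b _ _) _.
by rewrite tagnat.sig2K.
Qed.

(** Hence every coefficient of a form of multidegree [2 s] has a place in a Gram
matrix of it. *)
Lemma halve_multideg s m : has_multideg (twice s) m ->
  exists m1 m2, [/\ m = (m1 + m2)%MM, has_multideg s m1 & has_multideg s m2].
Proof.
move=> /has_multidegP ms.
have [i|m1 s1 le_m1] := @sub_multideg s m; first by rewrite ms leq_pmull.
exists m1, (m - m1)%MM; have m_eq : m = (m1 + (m - m1))%MM.
  by rewrite addmC submK.
split=> //; apply/has_multidegP => i; apply/eqP.
rewrite -(eqn_add2l (s i)) -{1}(has_multidegP _ _ s1 i) -blockdegD -m_eq ms.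
by rewrite addnn -mul2n.
Qed.

End Blocks.

Section Multiforms.

Variables (R : realType) (p : nat) (n : 'I_p -> nat).
Implicit Types (s t d : 'I_p -> nat) (f g h q : mvpoly R n).

Lemma multiformP d f :
  multiform d f <-> forall m, ~~ has_multideg d m -> f@_m = 0.
Proof.
split=> [fd m|fd m]; last first.
  by rewrite mcoeff_msupp; apply: contra_neqT => /fd.
by apply: contraNeq; rewrite -mcoeff_msupp => /fd.
Qed.

Lemma eq_multiform s t f : s =1 t -> multiform s f -> multiform t f.
Proof. by move=> st fs m /fs; rewrite (eq_has_multideg st). Qed.

Lemma multiform0 d : multiform d (0 : mvpoly R n).
Proof. by apply/multiformP => m _; rewrite mcoeff0. Qed.

Lemma multiformD d f g : multiform d f -> multiform d g -> multiform d (f + g).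
Proof.
move=> /multiformP fd /multiformP gd; apply/multiformP => m dm.
by rewrite mcoeffD fd ?gd ?addr0.
Qed.

Lemma multiformZ d c f : multiform d f -> multiform d (c *: f).
Proof.
by move=> /multiformP fd; apply/multiformP => m dm; rewrite mcoeffZ fd ?mulr0.
Qed.

Lemma multiformB d f g : multiform d f -> multiform d g -> multiform d (f - g).
Proof. by move=> fd gd; rewrite -scaleN1r; apply: multiformD => //; exact: multiformZ. Qed.

Lemma multiform_sum d (I : Type) (r : seq I) (F : I -> mvpoly R n) :
  (forall i, multiform d (F i)) -> multiform d (\sum_(i <- r) F i).
Proof.
move=> Fd; elim: r => [|i r IH]; rewrite ?big_nil ?big_cons.
  exact: multiform0.
exact: multiformD.
Qed.

Lemma multiformX d m : has_multideg d m -> multiform d ('X_[m] : mvpoly R n).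
Proof. by move=> dm m'; rewrite msuppX inE => /eqP ->. Qed.

Lemma multiform1 : multiform (fun=> 0%N) (1 : mvpoly R n).
Proof.
by rewrite -mpolyX0; apply: multiformX; apply/has_multidegP => i; rewrite blockdeg0.
Qed.

Lemma multiformM s t f g : multiform s f -> multiform t g ->
  multiform (fun i => s i + t i)%N (f * g).
Proof.
move=> fs gt m /msuppM_le /allpairsP[[m1 m2] /= [/fs sm1 /gt tm2 ->]].
exact: has_multidegD.
Qed.

Lemma multiformXn s f k : multiform s f -> multiform (fun i => k * s i)%N (f ^+ k).
Proof.
move=> fs; elim: k => [|k IH]; first by rewrite expr0; exact: multiform1.
by rewrite exprS; apply: eq_multiform (multiformM fs IH) => i; rewrite mulSn.
Qed.
Arguments multiformXn {s f} k.

Lemma multiform_prod (I : Type) (r : seq I) (e : I -> 'I_p -> nat)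
    (F : I -> mvpoly R n) :
  (forall i, multiform (e i) (F i)) ->
  multiform (fun j => \sum_(i <- r) e i j)%N (\prod_(i <- r) F i).
Proof.
move=> Fe; elim: r => [|i r IH].
  by rewrite big_nil; apply: eq_multiform multiform1 => j; rewrite big_nil.
rewrite big_cons; apply: eq_multiform (multiformM (Fe i) IH) => j.
by rewrite big_cons.
Qed.
Arguments multiform_prod {I} r {e F}.

Lemma multiform_xvar i (j : 'I_(n i)) :
  multiform (fun i' => (i == i') : nat) (xvar R n i j).
Proof. by apply: multiformX; apply/has_multidegP => i'; rewrite blockdeg1. Qed.
Arguments multiform_xvar {i} j.

(** Applied with [k = 1] to products of powers of the sums of the blocks and with
[k = 2] to [gpoly]. *)
Lemma multiform_blocks (F : 'I_p -> mvpoly R n) (k : nat) (s : 'I_p -> nat) :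
  (forall i, multiform (fun i' => k * (i == i'))%N (F i)) ->
  multiform (fun i => k * s i)%N (\prod_i F i ^+ s i).
Proof.
move=> Fk.
have := multiform_prod (index_enum 'I_p) (fun i => multiformXn (s i) (Fk i)).
apply: eq_multiform => j.
rewrite (bigD1 j) //= eqxx muln1 big1 => [|i /negbTE ->]; last by rewrite !muln0.
by rewrite addn0 mulnC.
Qed.

Lemma multiform_linear_blocks s :
  multiform s (\prod_i (\sum_(j < n i) xvar R n i j) ^+ s i).
Proof.
have F1 i : multiform (fun i' => 1 * (i == i'))%N (\sum_(j < n i) xvar R n i j).
  apply: multiform_sum => j.
  by apply: (eq_multiform _ (multiform_xvar j)) => i'; rewrite mul1n.
by apply: (eq_multiform _ (multiform_blocks F1)) => i; rewrite mul1n.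
Qed.

Lemma multiform_gpoly tau : multiform (twice tau) (gpoly R n tau).
Proof.
apply: multiform_blocks => i; apply: multiform_sum => j.
exact: multiformXn 2 (multiform_xvar j).
Qed.

Lemma multiformE d f : multiform d f ->
  f = \sum_(k < nmultidegs n d) f@_(multideg_nth k) *: 'X_[multideg_nth k].
Proof.
move=> fd; rewrite -(big_tnth _ _ (multidegs n d) xpredT (fun m => f@_m *: 'X_[m])).
rewrite [LHS]mpolyE [RHS](bigID (mem (msupp f))) /= [X in _ = _ + X]big1; last first.
  by move=> m; rewrite mcoeff_msupp negbK => /eqP ->; rewrite scale0r.
rewrite addr0 -[RHS]big_filter; apply: perm_big; apply: uniq_perm.
- exact: msupp_uniq.
- by rewrite filter_uniq // multidegs_uniq.
move=> m; rewrite mem_filter; apply/idP/andP => [fm|[]//].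
by split=> //; rewrite mem_multidegs fd.
Qed.

End Multiforms.

(** * Positive semidefinite matrices *)

Section PsdMatrices.

Variables (R : realType) (k : nat).
Implicit Types (S M : 'M[R]_k) (u v w : 'cV[R]_k).

Definition bilform S u v : R := (u^T *m S *m v) 0 0.

Lemma bilformE S u v : bilform S u v = \sum_i \sum_j u i 0 * S i j * v j 0.
Proof.
rewrite /bilform mxE exchange_big; apply: eq_bigr => j _.
by rewrite mxE mulr_suml; apply: eq_bigr => i _; rewrite mxE.
Qed.

(** The value of the form at [v + t *: u]; the facts below are choices of [t]. *)
Lemma psd_pencil S u v (t : R) : psd_mx S ->
  0 <= bilform S v v + 2 * t * bilform S u v + t ^+ 2 * bilform S u u.
Proof.
case=> S_sym S_ge0.
have vu : bilform S v u = bilform S u v.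
  have /matrixP/(_ 0 0) : (u^T *m S *m v)^T = v^T *m S *m u.
    by rewrite !trmx_mul trmxK S_sym mulmxA.
  by rewrite mxE.
have <- : bilform S (v + t *: u) (v + t *: u) =
    bilform S v v + 2 * t * bilform S u v + t ^+ 2 * bilform S u u.
  have -> : bilform S (v + t *: u) (v + t *: u) =
      ((v^T + t *: u^T) *m S *m (v + t *: u)) 0 0.
    by rewrite /bilform; congr ((_ *m S *m _) 0 0); apply/matrixP => a b; rewrite !mxE.
  rewrite !(mulmxDl, mulmxDr) -!scalemxAl -!scalemxAr.
  have addE (A B : 'M[R]_1) : (A + B) 0 0 = A 0 0 + B 0 0 by rewrite mxE.
  have scaleE a (A : 'M[R]_1) : (a *: A) 0 0 = a * A 0 0 by rewrite mxE.
  by rewrite !(addE, scaleE) -!/(bilform S _ _) vu; ring.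
exact: S_ge0.
Qed.

Lemma bilform_delta S i v : bilform S (delta_mx i 0) v = \sum_j S i j * v j 0.
Proof. by rewrite /bilform trmx_delta -rowE mxE; apply: eq_bigr => j _; rewrite mxE. Qed.

Lemma bilform_deltas S i j : bilform S (delta_mx i 0) (delta_mx j 0) = S i j.
Proof.
rewrite bilform_delta (bigD1 j) //= mxE !eqxx mulr1 big1 ?addr0 // => l ne_l.
by rewrite mxE (negbTE ne_l) mulr0.
Qed.

Lemma psd_diag_ge0 S i : psd_mx S -> 0 <= S i i.
Proof. by case=> _ /(_ (delta_mx i 0)); rewrite -/(bilform _ _ _) bilform_deltas. Qed.

Lemma psd_normr_le S i j : psd_mx S -> `|S i j| <= (S i i + S j j) / 2.
Proof.
move=> S_psd.
have := psd_pencil (delta_mx i 0) (delta_mx j 0) 1 S_psd.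
have := psd_pencil (delta_mx i 0) (delta_mx j 0) (-1) S_psd.
by rewrite !bilform_deltas ler_norml => h1 h2; apply/andP; split; lra.
Qed.

Lemma psd_diag0 S i : psd_mx S -> S i i = 0 -> forall j, S i j = 0.
Proof.
move=> S_psd Sii0 j; apply/eqP; apply: contraT => nz.
have := psd_pencil (delta_mx i 0) (delta_mx j 0) (- (S j j + 1) / S i j) S_psd.
rewrite !bilform_deltas Sii0 mulr0 addr0 mulrA divfK // => h.
have := psd_diag_ge0 j S_psd; lra.
Qed.

(** One step of symmetric elimination: completing the square in direction [i]
removes row [i] and keeps the form nonnegative. *)
Lemma psd_schur S i : psd_mx S ->
  psd_mx (\matrix_(a, b) (S a b - (S i i)^-1 * S i a * S i b)).
Proof.
move=> S_psd; have [S_sym _] := S_psd; split.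
  by apply/matrixP => a b; rewrite !mxE -{1}S_sym mxE; ring.
move=> v; rewrite -/(bilform _ _ _).
set b := bilform S (delta_mx i 0) v.
have -> : bilform (\matrix_(a, b) (S a b - (S i i)^-1 * S i a * S i b)) v v =
    bilform S v v - (S i i)^-1 * b ^+ 2.
  rewrite !bilformE /b bilform_delta expr2 mulr_suml mulr_sumr -sumrB.
  apply: eq_bigr => a _; rewrite !mulr_sumr -sumrB; apply: eq_bigr => c _.
  by rewrite mxE; ring.
have := psd_pencil (delta_mx i 0) v (- ((S i i)^-1 * b)) S_psd.
rewrite -/b bilform_deltas.
have [->|nz] := eqVneq (S i i) 0.
  by rewrite invr0 !(mul0r, oppr0, mulr0, addr0).
by congr (0 <= _); field.
Qed.

(** The cone of positive semidefinite matrices is contained in its dual: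
elimination writes [S] as a sum of squares of vectors. *)
Lemma psd_inner_ge0 S M : psd_mx S ->
  (forall w, 0 <= \sum_i \sum_j w i 0 * M i j * w j 0) ->
  0 <= \sum_i \sum_j S i j * M i j.
Proof.
move=> S_psd M_ge0.
have [r S0] : exists r, forall i j : 'I_k, (r <= i)%N -> S i j = 0.
  by exists k => i j; rewrite leqNgt ltn_ord.
elim: r S S_psd S0 => [S _ S0|r IH S S_psd S0].
  by rewrite big1 // => i _; rewrite big1 // => j _; rewrite S0 ?mul0r.
have [lt_rk|le_kr] := ltnP r k; last first.
  apply: IH => // i j /(leq_trans le_kr).
  by rewrite leqNgt ltn_ord.
pose i := Ordinal lt_rk; have [S_sym _] := S_psd.
have symE a b : S a b = S b a by rewrite -{1}S_sym mxE.
set S' := (\matrix_(a, b) (S a b - (S i i)^-1 * S i a * S i b)) : 'M[R]_k.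
have S'_ge0 : 0 <= \sum_a \sum_b S' a b * M a b.
  apply: IH => [|a b le_ra]; first exact: psd_schur.
  rewrite mxE; have [a_i|ne_ai] := eqVneq a i.
    rewrite a_i; have [Sii0|nz] := eqVneq (S i i) 0.
      by rewrite !(psd_diag0 S_psd Sii0) !(mulr0, mul0r) subr0.
    by rewrite mulVf // mul1r subrr.
  have lt_ra : (r < a)%N by rewrite ltn_neqAle le_ra andbT eq_sym.
  by rewrite (S0 a b) // (symE i a) (S0 a i) // mulr0 mul0r subr0.
have -> : \sum_a \sum_b S a b * M a b = \sum_a \sum_b S' a b * M a b +
    (S i i)^-1 * \sum_a \sum_b (\col_c S i c) a 0 * M a b * (\col_c S i c) b 0.
  rewrite mulr_sumr -big_split; apply: eq_bigr => a _ /=.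
  rewrite mulr_sumr -big_split; apply: eq_bigr => b _ /=.
  by rewrite !mxE; ring.
by rewrite addr_ge0 // mulr_ge0 ?invr_ge0 // psd_diag_ge0.
Qed.

End PsdMatrices.

(** * Doubly nonnegative functionals and weak duality *)

Definition nonneg_coefs (R : realType) (N : nat) (q : {mpoly R[N]}) : Prop :=
  forall m, 0 <= q@_m.

Lemma nonneg_coefsM (R : realType) (N : nat) (q r : {mpoly R[N]}) :
  nonneg_coefs q -> nonneg_coefs r -> nonneg_coefs (q * r).
Proof.
move=> q_ge0 r_ge0 m; rewrite mcoeffM; apply: sumr_ge0 => k _.
by rewrite mulr_ge0.
Qed.

Lemma nonneg_coefsX (R : realType) (N : nat) (m : 'X_{1..N}) :
  nonneg_coefs ('X_[m] : {mpoly R[N]}).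
Proof. by move=> m'; rewrite mcoeffX ler0n. Qed.

Lemma nonneg_coefs_sum (R : realType) (N : nat) (I : Type) (s : seq I)
    (F : I -> {mpoly R[N]}) :
  (forall i, nonneg_coefs (F i)) -> nonneg_coefs (\sum_(i <- s) F i).
Proof. by move=> F_ge0 m; rewrite raddf_sum; apply: sumr_ge0 => i _; exact: F_ge0. Qed.

Lemma nonneg_coefs_prod (R : realType) (N : nat) (I : Type) (s : seq I)
    (F : I -> {mpoly R[N]}) :
  (forall i, nonneg_coefs (F i)) -> nonneg_coefs (\prod_(i <- s) F i).
Proof.
move=> F_ge0; elim/big_rec: _ => [m|i q _]; first by rewrite mcoeff1 ler0n.
exact: nonneg_coefsM.
Qed.

Lemma nonneg_coefsXn (R : realType) (N : nat) (q : {mpoly R[N]}) k :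
  nonneg_coefs q -> nonneg_coefs (q ^+ k).
Proof. by move=> q_ge0; rewrite -(card_ord k) -prodr_const; exact: nonneg_coefs_prod. Qed.

Section Functionals.

Variables (R : realType) (p : nat) (n : 'I_p -> nat).
Implicit Types (s t d : 'I_p -> nat) (f g h q L : mvpoly R n).
Implicit Types (l : {scalar mvpoly R n}).

(** The dual cone of [SigmaPlus s]: on forms of multidegree [2 s] a functional is
given by its moments, and the two conditions make its moment matrix positive
semidefinite and entrywise nonnegative. *)
Definition dnn_functional s l : Prop :=
  (forall q, multiform s q -> 0 <= l (q * q)) /\
  (forall m1 m2, has_multideg s m1 -> has_multideg s m2 ->
     0 <= l 'X_[m1 + m2]).

Definition mul_functional L l : mvpoly R n -> R := fun q => l (L * q).

Lemma mul_functional_is_linear L l : scalar (mul_functional L l).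
Proof.
move=> a u v; rewrite /mul_functional mulrDr linearD; congr (_ + _).
by rewrite -scalerAr linearZ.
Qed.

HB.instance Definition _ L l :=
  GRing.isLinear.Build R (mvpoly R n) R _ (mul_functional L l)
    (mul_functional_is_linear L l).

Definition coef_functional s (y : 'cV[R]_(nmultidegs n s)) : mvpoly R n -> R :=
  fun q => \sum_k y k 0 * q@_(multideg_nth k).

Lemma coef_functional_is_linear s y : scalar (@coef_functional s y).
Proof.
move=> a u v; rewrite /coef_functional mulr_sumr -big_split.
by apply: eq_bigr => k _; rewrite /= mcoeffD mcoeffZ mulrDr mulrCA.
Qed.

HB.instance Definition _ s y :=
  GRing.isLinear.Build R (mvpoly R n) R _ (@coef_functional s y)
    (coef_functional_is_linear y).

Lemma coef_functionalX s y (k : 'I_(nmultidegs n s)) :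
  coef_functional y 'X_[multideg_nth k] = y k 0.
Proof.
rewrite /coef_functional (bigD1 k) //= mcoeffX eqxx mulr1 [X in _ + X]big1 => [|j ne].
  by rewrite addr0.
by rewrite mcoeffX (inj_eq (@multideg_nth_inj _ _ _)) eq_sym (negbTE ne) mulr0.
Qed.

Lemma functional_multiform d l f : multiform d f ->
  l f = \sum_(k < nmultidegs n d) f@_(multideg_nth k) * l 'X_[multideg_nth k].
Proof.
move=> fd; rewrite {1}(multiformE fd) linear_sum.
by apply: eq_bigr => k _; rewrite linearZ.
Qed.

Lemma dnn_coef_ge0 s l m :
  dnn_functional s l -> has_multideg (twice s) m -> 0 <= l 'X_[m].
Proof. by case=> _ l_ge0 /halve_multideg[m1 [m2 [-> s1 s2]]]; exact: l_ge0. Qed.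

Lemma dnn_nonneg_coefs s l h : dnn_functional s l ->
  multiform (twice s) h -> nonneg_coefs h -> 0 <= l h.
Proof.
move=> l_dnn hs h_ge0; rewrite (functional_multiform l hs).
apply: sumr_ge0 => k _; apply: mulr_ge0 => //.
by apply: (dnn_coef_ge0 l_dnn); exact: multidegs_nth.
Qed.

(** Evaluation at a nonnegative point sends squares and monomials to
nonnegative numbers. *)
Lemma dnn_meval s (v : 'I_(nvars n) -> R) : (forall k, 0 <= v k) ->
  dnn_functional s (meval v).
Proof.
move=> v_ge0; split=> [q _|m1 m2 _ _] /=; first by rewrite mevalM -expr2 sqr_ge0.
by rewrite mevalX prodr_ge0 // => k _; rewrite exprn_ge0.
Qed.

(** Multiplication by [L ^+ 2] maps squares of forms to squares of forms and, as
[L] has nonnegative coefficients, products of monomials to forms that are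
nonnegative combinations of monomials. *)
Lemma dnn_mul_functional s t l L : dnn_functional (fun i => t i + s i)%N l ->
  multiform t L -> nonneg_coefs L -> dnn_functional s (mul_functional (L * L) l).
Proof.
move=> l_dnn Lt L_ge0; have [l_sqr _] := l_dnn.
split=> [q qs|m1 m2 s1 s2]; rewrite /= /mul_functional.
  by rewrite mulrACA; apply: l_sqr; exact: multiformM.
rewrite mpolyXD mulrACA; apply: (dnn_nonneg_coefs l_dnn).
  have := multiformM (multiformM Lt (multiformX s1)) (multiformM Lt (multiformX s2)).
  by apply: eq_multiform => i; rewrite /twice mul2n addnn.
by do 2!apply: nonneg_coefsM => //; exact: nonneg_coefsX.
Qed.

Definition gram_form s (A : 'M[R]_(nmultidegs n s)) : mvpoly R n :=
  \sum_i \sum_j A i j *: 'X_[multideg_nth i + multideg_nth j].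

Lemma gram_formE s (A : 'M[R]_(nmultidegs n s)) :
  ((monomials R n s)^T *m map_mx (@mpolyC (nvars n) R) A *m monomials R n s) 0 0 =
  gram_form A.
Proof.
rewrite mxE /gram_form exchange_big; apply: eq_bigr => j _.
rewrite mxE mulr_suml; apply: eq_bigr => i _.
by rewrite !mxE mpolyXD [X in X * _]mulrC mul_mpolyC scalerAl.
Qed.

Lemma gram_formD s (A B : 'M[R]_(nmultidegs n s)) :
  gram_form (A + B) = gram_form A + gram_form B.
Proof.
rewrite /gram_form -big_split; apply: eq_bigr => i _.
by rewrite -big_split; apply: eq_bigr => j _; rewrite mxE scalerDl.
Qed.

Lemma gram_formZ s c (A : 'M[R]_(nmultidegs n s)) :
  gram_form (c *: A) = c *: gram_form A.
Proof.
rewrite /gram_form scaler_sumr; apply: eq_bigr => i _; rewrite scaler_sumr.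
by apply: eq_bigr => j _; rewrite mxE scalerA.
Qed.

Lemma multiform_gram_form s (A : 'M[R]_(nmultidegs n s)) :
  multiform (twice s) (gram_form A).
Proof.
apply: multiform_sum => i; apply: multiform_sum => j; apply: multiformZ.
have := multiformX (R := R) (has_multidegD (multidegs_nth i) (multidegs_nth j)).
by apply: eq_multiform => k; rewrite /twice mul2n addnn.
Qed.
Lemma functional_gram_form s l (A : 'M[R]_(nmultidegs n s)) :
  l (gram_form A) = \sum_i \sum_j A i j * l 'X_[multideg_nth i + multideg_nth j].
Proof.
rewrite /gram_form linear_sum; apply: eq_bigr => i _; rewrite linear_sum.
by apply: eq_bigr => j _; rewrite linearZ.
Qed.

Lemma gram_form_sqr s (w : 'cV[R]_(nmultidegs n s)) :
  gram_form (w *m w^T) =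
  (\sum_i w i 0 *: 'X_[multideg_nth i]) * (\sum_i w i 0 *: 'X_[multideg_nth i]).
Proof.
rewrite mulr_suml; apply: eq_bigr => i _; rewrite mulr_sumr; apply: eq_bigr => j _.
by rewrite mxE big_ord1 mxE -scalerAl -scalerAr scalerA mpolyXD.
Qed.

Lemma SigmaPlusP s h : SigmaPlus s h <->
  exists S T : 'M[R]_(nmultidegs n s),
    [/\ psd_mx S, nonneg_mx T & h = gram_form (S + T)].
Proof.
split=> [[_ [S [T [S_psd T_ge0]]]]|[S [T [S_psd T_ge0 ->]]]].
  by rewrite gram_formE; exists S, T.
split; first exact: multiform_gram_form.
by exists S, T; rewrite gram_formE.
Qed.

(** Weak duality: the value of [l] is the inner product of [S + T] with the moment
matrix, which is nonnegative with [S] by semidefiniteness and with [T] entry by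
entry. *)
Lemma SigmaPlus_dnn s l h : SigmaPlus s h -> dnn_functional s l -> 0 <= l h.
Proof.
move=> /SigmaPlusP[S [T [S_psd T_ge0 ->]]] [l_sqr l_ge0].
rewrite gram_formD linearD addr_ge0 //= functional_gram_form; last first.
  apply: sumr_ge0 => i _; apply: sumr_ge0 => j _; apply: mulr_ge0 => //.
  by apply: l_ge0; exact: multidegs_nth.
pose M : 'M[R]_(nmultidegs n s) :=
  \matrix_(i, j) l 'X_[multideg_nth i + multideg_nth j].
have -> : \sum_i \sum_j S i j * l 'X_[multideg_nth i + multideg_nth j] =
    \sum_i \sum_j S i j * M i j.
  by apply: eq_bigr => i _; apply: eq_bigr => j _; rewrite mxE.
apply: psd_inner_ge0 => // w.
have -> : \sum_i \sum_j w i 0 * M i j * w j 0 = l (gram_form (w *m w^T)).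
  rewrite functional_gram_form; apply: eq_bigr => i _; apply: eq_bigr => j _.
  by rewrite !mxE big_ord1 mxE mulrAC.
rewrite gram_form_sqr; apply: l_sqr; apply: multiform_sum => i.
by apply: multiformZ; apply: multiformX; exact: multidegs_nth.
Qed.

End Functionals.

Arguments multiform_gram_form {R p n s} A.

(** * Boundedness of Gram matrices *)

Definition grid_point (R : realType) (N D : nat) (g : {ffun 'I_N -> 'I_D}) :
    'I_N -> R := fun k => (g k).+1%:R.
Arguments grid_point R {N D} g k.

(** A coefficient of a polynomial with exponents below [D] is a combination of
its values on a grid with [D] points in each direction: the inverse Vandermonde
matrix gives this in one variable, and the tensor product in several. *)
Lemma grid_interpolation (R : realType) (N D : nat) (e : 'X_{1..N}) :
  (forall k, e k < D)%N ->
  exists a : {ffun 'I_N -> 'I_D} -> R, forall m : 'X_{1..N},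
    (forall k, m k < D)%N ->
    \sum_g a g * \prod_k grid_point R g k ^+ m k = (e == m)%:R.
Proof.
move=> e_lt; pose V := Vandermonde D (\row_(u < D) (u.+1%:R : R)).
(* The nodes 1, 2, ..., D are distinct in characteristic 0. *)
have V_unit : V \in unitmx.
  rewrite unitmxE unitfE det_Vandermonde prodf_seq_neq0.
  apply/allP => u _; rewrite prodf_seq_neq0; apply/allP => v _; apply/implyP => lt_uv.
  by rewrite !mxE subr_eq0 eqr_nat eqSS gtn_eqF.
pose E k := Ordinal (e_lt k).
exists (fun g => \prod_k invmx V (g k) (E k)) => m m_lt.
under eq_bigr do rewrite -big_split /=.
rewrite -(bigA_distr_bigA (fun k (u : 'I_D) => invmx V u (E k) * u.+1%:R ^+ m k)).
have prodE k : \sum_u invmx V u (E k) * u.+1%:R ^+ m k = (e k == m k)%:R.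
  have /matrixP/(_ (Ordinal (m_lt k)) (E k)) := mulmxV V_unit.
  rewrite !mxE -val_eqE /= eq_sym => <-; apply: eq_bigr => u _.
  by rewrite !mxE mulrC.
under eq_bigr do rewrite prodE.
have [->|ne] := eqVneq e m; first by rewrite big1 // => k _; rewrite eqxx.
have [k ne_k] : exists k, e k != m k.
  apply/existsP; apply: contraNT ne; rewrite negb_exists => /forallP eq_em.
  by apply/eqP/mnmP => k; apply/eqP; rewrite -[_ == _]negbK eq_em.
by rewrite (bigD1 k) //= (negbTE ne_k) mul0r.
Qed.

Lemma bilform_sum (R : realType) (k : nat) (S : 'M[R]_k) (J : finType)
    (a : J -> R) (w : J -> 'cV[R]_k) :
  bilform S (\sum_g a g *: w g) (\sum_g a g *: w g) =
  \sum_g \sum_h a g * a h * bilform S (w g) (w h).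
Proof.
rewrite /bilform [_^T]linear_sum /= !mulmx_suml summxE; apply: eq_bigr => g _.
rewrite mulmx_sumr summxE; apply: eq_bigr => h _.
have -> : (a g *: w g)^T = a g *: (w g)^T by apply/matrixP => x y; rewrite !mxE.
by rewrite -!scalemxAl -scalemxAr scalerA mxE.
Qed.

(** A weak form of the Cauchy-Schwarz inequality, from
[2 |S(u, v)| <= S(u, u) + S(v, v)]. *)
Lemma psd_bilform_sum_le (R : realType) (k : nat) (S : 'M[R]_k) (J : finType)
    (a : J -> R) (w : J -> 'cV[R]_k) : psd_mx S ->
  bilform S (\sum_g a g *: w g) (\sum_g a g *: w g) <=
  (\sum_g `|a g|) ^+ 2 * \sum_g bilform S (w g) (w g).
Proof.
move=> S_psd; rewrite bilform_sum.
have S_ge0 g : 0 <= bilform S (w g) (w g) by case: S_psd => _; exact.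
set t := \sum_g bilform S (w g) (w g).
have le_t g : bilform S (w g) (w g) <= t.
  by rewrite /t (bigD1 g) //= lerDl sumr_ge0.
clearbody t; rewrite expr2 mulr_suml mulr_suml; apply: ler_sum => g _.
rewrite mulr_sumr mulr_suml; apply: ler_sum => h _.
apply: le_trans (ler_norm _) _; rewrite !normrM ler_wpM2l ?mulr_ge0 //.
have := psd_pencil (w g) (w h) 1 S_psd.
have := psd_pencil (w g) (w h) (-1) S_psd.
have := le_t g; have := le_t h.
by rewrite ler_norml => *; apply/andP; split; lra.
Qed.

Section GramBounds.

Variables (R : realType) (p : nat) (n : 'I_p -> nat) (s : 'I_p -> nat).
Implicit Types (S T A : 'M[R]_(nmultidegs n s)).

Definition monomials_at (v : 'I_(nvars n) -> R) : 'cV[R]_(nmultidegs n s) :=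
  \col_k ('X_[multideg_nth k]).@[v].

Lemma meval_gram_form A v :
  (gram_form A).@[v] = bilform A (monomials_at v) (monomials_at v).
Proof.
rewrite bilformE [LHS](functional_gram_form (meval v)).
apply: eq_bigr => i _; apply: eq_bigr => j _.
by rewrite !mxE mpolyXD /= mevalM mulrCA mulrA.
Qed.

(* Larger than every exponent of a monomial of multidegree s. *)
Let D := (\sum_i s i).+1.

Lemma multideg_nth_lt (k : 'I_(nmultidegs n s)) j : (multideg_nth k j < D)%N.
Proof.
have /has_multidegP sk := multidegs_nth k.
rewrite ltnS -(eq_bigr _ (fun i _ => sk i)) -mdeg_blockdeg mdegE (bigD1 j) //=.
exact: leq_addr.
Qed.

Definition grid_sum : mvpoly R n -> R :=
  fun q => \sum_(g : {ffun 'I_(nvars n) -> 'I_D}) q.@[grid_point R g].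

Lemma grid_sum_is_linear : scalar grid_sum.
Proof.
move=> a u v; rewrite /grid_sum mulr_sumr -big_split.
by apply: eq_bigr => g _; rewrite mevalD mevalZ.
Qed.

HB.instance Definition _ :=
  GRing.isLinear.Build R (mvpoly R n) R _ grid_sum grid_sum_is_linear.

Lemma grid_sum_psd_ge0 S : psd_mx S -> 0 <= grid_sum (gram_form S).
Proof.
by case=> _ S_ge0; apply: sumr_ge0 => g _; rewrite meval_gram_form S_ge0.
Qed.

(** Every monomial is at least [1] at a grid point, as the coordinates start
at [1]. *)
Lemma grid_sum_nonneg_ge T i j : nonneg_mx T -> T i j <= grid_sum (gram_form T).
Proof.
move=> T_ge0; pose g0 : {ffun 'I_(nvars n) -> 'I_D} := [ffun=> ord0].
have v_ge1 g k : 1 <= @grid_point R (nvars n) D g k by rewrite ler1n.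
have m_ge1 g a : 1 <= monomials_at (@grid_point R (nvars n) D g) a 0.
  rewrite mxE mevalX; apply: (big_ind (fun x : R => 1 <= x)) => // [x y x1 y1|k _].
    exact: mulr_ege1.
  exact: exprn_ege1.
have m_ge0 g a : 0 <= monomials_at (@grid_point R (nvars n) D g) a 0.
  exact: le_trans ler01 (m_ge1 g a).
have term_ge0 g a b : 0 <= monomials_at (@grid_point R (nvars n) D g) a 0 * T a b *
    monomials_at (grid_point R g) b 0 by rewrite !mulr_ge0.
rewrite /grid_sum (bigD1 g0) //= ler_wpDr //.
  apply: sumr_ge0 => g _; rewrite meval_gram_form bilformE.
  by apply: sumr_ge0 => a _; apply: sumr_ge0.
rewrite meval_gram_form bilformE (bigD1 i) //= ler_wpDr //.
  by apply: sumr_ge0 => a _; apply: sumr_ge0.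
rewrite (bigD1 j) //= ler_wpDr ?sumr_ge0 //.
apply: (@le_trans _ _ (T i j * monomials_at (grid_point R g0) j 0)).
  by apply: ler_peMr.
by apply: ler_wpM2r => //; apply: ler_peMl.
Qed.

(** By interpolation the unit vectors are combinations of the vectors
[monomials_at] on the grid, so the diagonal of [S] is controlled by the values of
its form there. *)
Lemma grid_sum_psd_ge : exists2 c, 0 <= c &
  forall S i, psd_mx S -> S i i <= c * grid_sum (gram_form S).
Proof.
have pick i := grid_interpolation R (multideg_nth_lt i).
pose a i := sval (cid (pick i)).
exists (\sum_i (\sum_g `|a i g|) ^+ 2) => [|S i S_psd].
  by apply: sumr_ge0 => i _; rewrite sqr_ge0.
have aP : delta_mx i 0 = \sum_g a i g *: monomials_at (grid_point R g).
  apply/colP => j; rewrite summxE mxE eqxx andbT.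
  have := svalP (cid (pick i)) (multideg_nth j) (multideg_nth_lt j).
  rewrite (inj_eq (@multideg_nth_inj _ _ _)) eq_sym => <-.
  by apply: eq_bigr => g _; rewrite !mxE mevalX.
rewrite -bilform_deltas aP; apply: le_trans (psd_bilform_sum_le _ _ S_psd) _.
have -> : grid_sum (gram_form S) = \sum_g bilform S (monomials_at (grid_point R g))
    (monomials_at (@grid_point R (nvars n) D g)).
  by apply: eq_bigr => g _; rewrite meval_gram_form.
rewrite ler_wpM2r //.
  by apply: sumr_ge0 => g _; case: S_psd => _; exact.
by rewrite (bigD1 i) //= lerDl sumr_ge0 // => j _; rewrite sqr_ge0.
Qed.

(** The Gram matrices of forms with bounded coefficients are bounded: the sum of
the values on a grid of positive points controls both summands, as it is
nonnegative on each of them. *)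
Lemma gram_bounded (b : R) : exists B : R, forall S T,
  psd_mx S -> nonneg_mx T ->
  (forall k : 'I_(nmultidegs n (twice s)),
     `|(gram_form (S + T))@_(multideg_nth k)| <= b) ->
  forall i j, `|S i j| <= B /\ `|T i j| <= B.
Proof.
have [c c_ge0 S_le] := grid_sum_psd_ge.
pose e := \sum_(k < nmultidegs n (twice s)) `|grid_sum 'X_[multideg_nth k]| * b.
exists (c * e + e) => S T S_psd T_ge0 coef_le.
have le_e : grid_sum (gram_form (S + T)) <= e.
  rewrite (functional_multiform _ (multiform_gram_form _)); apply: ler_sum => k _.
  apply: le_trans (ler_norm _) _; rewrite normrM [leLHS]mulrC; apply: ler_wpM2l.
    exact: normr_ge0.
  exact: coef_le.
move: le_e; rewrite gram_formD linearD /= => le_e.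
have S_pos := grid_sum_psd_ge0 S_psd.
move=> i j; have Tij_ge0 := T_ge0 i j.
have Tij_le := grid_sum_nonneg_ge i j T_ge0.
have Se : grid_sum (gram_form S) <= e by lra.
have Te : grid_sum (gram_form T) <= e by lra.
have e_ge0 : 0 <= e by lra.
have ce_ge0 : 0 <= c * e by rewrite mulr_ge0.
split.
  apply: le_trans (psd_normr_le i j S_psd) _.
  have := S_le S i S_psd; have := S_le S j S_psd.
  have : c * grid_sum (gram_form S) <= c * e by rewrite ler_wpM2l.
  lra.
rewrite ger0_norm //; lra.
Qed.

End GramBounds.

(** * Strong duality for the cone of Gram forms *)

Lemma psd_mx0 (R : realType) k : psd_mx (0 : 'M[R]_k).
Proof. by split=> [|v]; rewrite ?trmx0 // mulmx0 mul0mx mxE. Qed.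

Lemma psd_mxD (R : realType) k (S1 S2 : 'M[R]_k) :
  psd_mx S1 -> psd_mx S2 -> psd_mx (S1 + S2).
Proof.
move=> [sym1 ge1] [sym2 ge2]; split=> [|v].
  by apply/matrixP => i j; rewrite !mxE -{1}sym1 -{1}sym2 !mxE.
by rewrite mulmxDr mulmxDl mxE addr_ge0.
Qed.

Lemma psd_mxZ (R : realType) k (S : 'M[R]_k) c :
  0 <= c -> psd_mx S -> psd_mx (c *: S).
Proof.
move=> c_ge0 [sym ge]; split=> [|v].
  by apply/matrixP => i j; rewrite !mxE -{1}sym mxE.
by rewrite -scalemxAr -scalemxAl mxE mulr_ge0.
Qed.

Lemma psd_mx_sqr (R : realType) k (w : 'cV[R]_k) : psd_mx (w *m w^T).
Proof.
split=> [|v]; first by rewrite trmx_mul trmxK.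
have -> : v^T *m (w *m w^T) *m v = (w^T *m v)^T *m (w^T *m v).
  by rewrite trmx_mul trmxK !mulmxA.
by rewrite mxE big_ord1 mxE -expr2 sqr_ge0.
Qed.

(** For small [t] the quadratic term is negligible. *)
Lemma first_order (R : realFieldType) (a b : R) :
  (forall t, 0 < t <= 1 -> 0 <= - (2 * t * a) + t ^+ 2 * b) -> a <= 0.
Proof.
move=> ge0; rewrite leNgt; apply/negP => a_gt0.
have b1 : 0 < `|b| + a by rewrite ltr_wpDl.
have t_gt0 : 0 < a / (`|b| + a) by rewrite divr_gt0.
have t_le1 : a / (`|b| + a) <= 1 by rewrite ler_pdivrMr // mul1r lerDr.
have := ge0 (a / (`|b| + a)); rewrite t_gt0 t_le1 => /(_ isT).
set t := a / _ in t_gt0 t_le1 *; rewrite -mulrA mulrCA expr2 -mulrA -mulrN -mulrDr.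
rewrite pmulr_rge0 // => h.
have tb : t * b <= a.
  apply: le_trans (_ : t * `|b| <= _); first by rewrite ler_wpM2l ?ler_norm ?ltW.
  by rewrite /t mulrAC ler_pdivrMr // ler_wpM2l ?lerDl // ltW.
lra.
Qed.

Section Nearest.

Variables (R : realType) (p : nat) (n : 'I_p -> nat) (s : 'I_p -> nat).
Implicit Types (S T A : 'M[R]_(nmultidegs n s)) (h : mvpoly R n).

Definition gram_dist h A : R :=
  \sum_(k < nmultidegs n (twice s)) (h@_(multideg_nth k) -
     (gram_form A)@_(multideg_nth k)) ^+ 2.

Local Notation K := (nmultidegs n s).

(** The minimum is taken over the pairs [(S, T)] that are at least as near to [h] as
[(0, 0)]; this set is compact by [gram_bounded]. *)
Lemma nearest_gram h : exists S T, [/\ psd_mx S, nonneg_mx T &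
  forall S' T', psd_mx S' -> nonneg_mx T' ->
    gram_dist h (S + T) <= gram_dist h (S' + T')].
Proof.
pose Sof (z : 'rV[R]_(K * K + K * K)) : 'M[R]_K := vec_mx (lsubmx z).
pose Tof (z : 'rV[R]_(K * K + K * K)) : 'M[R]_K := vec_mx (rsubmx z).
pose zof (S T : 'M[R]_K) := row_mx (mxvec S) (mxvec T).
have SofK S T : Sof (zof S T) = S by rewrite /Sof row_mxKl mxvecK.
have TofK S T : Tof (zof S T) = T by rewrite /Tof row_mxKr mxvecK.
have Slin a u v : Sof (a *: u + v) = a *: Sof u + Sof v by rewrite /Sof !linearP.
have Tlin a u v : Tof (a *: u + v) = a *: Tof u + Tof v by rewrite /Tof !linearP.
pose dist z := gram_dist h (Sof z + Tof z).
have dist_cont : continuous dist.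
  apply: continuous_sum_rV => k.
  have c_cont : continuous (fun z : 'rV[R]_(K * K + K * K) => h@_(multideg_nth k) -
      (gram_form (Sof z + Tof z))@_(multideg_nth k)).
    move=> z; apply: continuousB; first exact: cst_continuous.
    apply: continuous_linear_rV => {z} a u v.
    rewrite Slin Tlin addrACA -scalerDr (gram_formD (a *: _)) (gram_formZ a).
    by rewrite mcoeffD mcoeffZ.
  by move=> z; exact: (continuousM (c_cont z) (c_cont z)).
pose H := \sum_(k < nmultidegs n (twice s)) (h@_(multideg_nth k)) ^+ 2.
have dist0 : gram_dist h (0 + 0) = H.
  have gram0 : gram_form (0 : 'M[R]_K) = 0.
    by have := gram_formZ 0 (0 : 'M[R]_K); rewrite !scale0r.
  by apply: eq_bigr => k _; rewrite addr0 gram0 mcoeff0 subr0.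
pose b := \sum_(k < nmultidegs n (twice s)) `|h@_(multideg_nth k)| + (H + 1).
have H_ge0 : 0 <= H by apply: sumr_ge0 => k _; rewrite sqr_ge0.
have sqr_near (x y c : R) : `|x| <= c -> (x - y) ^+ 2 <= H -> `|y| <= c + (H + 1).
  move=> x_le xy_le; have : `|x - y| <= H + 1.
    rewrite -ler_sqr ?nnegrE ?addr_ge0 ?ler01 // real_normK ?num_real //.
    by apply: le_trans xy_le _; rewrite sqrrD1; have := sqr_ge0 H; lra.
  by move: x_le; rewrite !ler_norml => /andP[? ?] /andP[? ?]; apply/andP; split; lra.
have [B BP] := gram_bounded n s b.
pose A := [set z | [/\ psd_mx (Sof z), nonneg_mx (Tof z) & dist z <= H]].
have A0 : A (zof 0 0).
  split; rewrite /dist ?SofK ?TofK ?dist0 //; first exact: psd_mx0.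
  by move=> i j; rewrite mxE.
have A_bounded z : A z -> forall j, `|z 0 j| <= B.
  move=> [S_psd T_ge0 dist_le] j.
  have zE : z = zof (Sof z) (Tof z) by rewrite /zof !vec_mxK hsubmxK.
  have {}BP : forall i j, `|Sof z i j| <= B /\ `|Tof z i j| <= B.
    apply: BP => // k.
    have le_h : `|h@_(multideg_nth k)| <=
        \sum_(k < nmultidegs n (twice s)) `|h@_(multideg_nth k)|.
      by rewrite (bigD1 k) //= lerDl sumr_ge0.
    have : (h@_(multideg_nth k) - (gram_form (Sof z + Tof z))@_(multideg_nth k)) ^+ 2
        <= H.
      apply: le_trans dist_le; rewrite /dist /gram_dist (bigD1 k) //= lerDl.
      by apply: sumr_ge0 => j' _; rewrite sqr_ge0.
    exact: (sqr_near _ _ _ le_h).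
  rewrite zE mxE; case: splitP => k _; case/mxvec_indexP: k => i1 i2; rewrite mxvecE.
    by have [] := BP i1 i2.
  by have [] := BP i1 i2.
have A_closed z : (forall q : 'rV[R]_(K * K + K * K) -> R, continuous q ->
    (forall w, A w -> 0 <= q w) -> 0 <= q z) -> A z.
  move=> Az; split.
  - split=> [|v].
      apply/matrixP => i j; rewrite mxE; apply/eqP.
      rewrite eq_le -subr_ge0 -[X in _ && X]subr_ge0.
      apply/andP; split.
        apply: (Az (fun w => Sof w i j - Sof w j i)) => [|w [[w_sym _] _ _]].
          by apply: continuous_linear_rV => a u v; rewrite Slin !mxE; ring.
        by rewrite -{1}w_sym mxE subrr.
      apply: (Az (fun w => Sof w j i - Sof w i j)) => [|w [[w_sym _] _ _]].
        by apply: continuous_linear_rV => a u v; rewrite Slin !mxE; ring.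
      by rewrite -{1}w_sym mxE subrr.
    apply: (Az (fun w => (v^T *m Sof w *m v) 0 0)) => [|w [[_ w_ge0] _ _]] //.
    apply: continuous_linear_rV => a u w.
    by rewrite Slin mulmxDr mulmxDl -scalemxAr -scalemxAl !mxE.
  - move=> i j; apply: (Az (fun w => Tof w i j)) => [|w [_ w_ge0 _]] //.
    by apply: continuous_linear_rV => a u v; rewrite Tlin !mxE.
  - rewrite -subr_ge0; apply: (Az (fun w => H - dist w)) => [w|w [_ _ le_H]].
      by apply: continuousB; [exact: cst_continuous | exact: dist_cont].
    by rewrite subr_ge0.
have [z [S_psd T_ge0 dist_le] z_min] :=
  min_attained A_closed A_bounded (ex_intro _ _ A0) dist_cont.
exists (Sof z), (Tof z); split=> // S' T' S'_psd T'_ge0.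
have [le_H|/ltW H_le] := leP (gram_dist h (S' + T')) H.
  have := z_min (zof S' T'); rewrite /A /dist /= SofK TofK; exact.
exact: le_trans dist_le H_le.
Qed.

Lemma gram_form_delta (i j : 'I_K) :
  gram_form (delta_mx i j) = 'X_[multideg_nth i + multideg_nth j] :> mvpoly R n.
Proof.
rewrite /gram_form (bigD1 i) //= (bigD1 j) //= mxE !eqxx scale1r.
rewrite [X in _ + X + _]big1 => [|b /negbTE nb]; last by rewrite mxE nb andbF scale0r.
rewrite [X in _ + X]big1 ?addr0 // => a /negbTE na; apply: big1 => b _.
by rewrite mxE na scale0r.
Qed.

Lemma gram_distB h A B t : gram_dist h (A + t *: B) = gram_dist h A -
    2 * t * (\sum_(k < nmultidegs n (twice s))
       (h - gram_form A)@_(multideg_nth k) * (gram_form B)@_(multideg_nth k)) +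
    t ^+ 2 * \sum_(k < nmultidegs n (twice s)) (gram_form B)@_(multideg_nth k) ^+ 2.
Proof.
rewrite /gram_dist !mulr_sumr -sumrB -big_split; apply: eq_bigr => k _ /=.
by rewrite (gram_formD A) (gram_formZ t) !mcoeffD mcoeffN mcoeffZ; ring.
Qed.

(** Strong duality: let [r] be the residual of [h] at a nearest point [G] of the
cone.  Optimality in the directions of the cone gives [<r, _> <= 0] on the cone,
so that [- <r, _>] is doubly nonnegative; optimality in the direction [- G] gives
[<r, G> >= 0].  Hence [<r, r> = <r, h> - <r, G> <= 0]. *)
Lemma dnn_SigmaPlus h : multiform (twice s) h ->
  (forall l : {scalar mvpoly R n}, dnn_functional s l -> 0 <= l h) ->
  SigmaPlus s h.
Proof.
move=> hs h_dual; have [S [T [S_psd T_ge0 ST_min]]] := nearest_gram h.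
set r := h - gram_form (S + T).
pose ip (f : mvpoly R n) :=
  \sum_(k < nmultidegs n (twice s)) r@_(multideg_nth k) * f@_(multideg_nth k).
have ip_le0 S' T' : psd_mx S' -> nonneg_mx T' -> ip (gram_form (S' + T')) <= 0.
  move=> S'_psd T'_ge0; apply: first_order => t /andP[/ltW t_ge0 _].
  have := ST_min (S + t *: S') (T + t *: T').
  rewrite addrACA -scalerDr gram_distB => le_dist.
  have /le_dist {le_dist} : psd_mx (S + t *: S') by apply: psd_mxD => //; exact: psd_mxZ.
  have T''_ge0 : nonneg_mx (T + t *: T').
    by move=> i j; rewrite !mxE addr_ge0 // mulr_ge0.
  by move=> /(_ T''_ge0); rewrite -/r -/(ip _) -addrA lerDl; exact.
have ip_ge0 : 0 <= ip (gram_form (S + T)).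
  rewrite -oppr_le0; apply: first_order => t /andP[/ltW t_ge0 t_le1].
  have := ST_min ((1 - t) *: S) ((1 - t) *: T).
  have -> : (1 - t) *: S + (1 - t) *: T = (S + T) + (- t) *: (S + T).
    by rewrite -scalerDr scalerBl scale1r scaleNr.
  rewrite gram_distB => le_dist.
  have /le_dist {le_dist} : psd_mx ((1 - t) *: S) by apply: psd_mxZ; rewrite ?subr_ge0.
  have T''_ge0 : nonneg_mx ((1 - t) *: T).
    by move=> i j; rewrite !mxE mulr_ge0 ?subr_ge0.
  move=> /(_ T''_ge0); rewrite -/r -/(ip _) -addrA lerDl sqrrN.
  by rewrite mulrN mulNr mulrN; exact.
pose l : {scalar mvpoly R n} :=
  coef_functional (- \col_(k < nmultidegs n (twice s)) r@_(multideg_nth k)).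
have lE f : l f = - ip f.
  rewrite /l /= /coef_functional /ip -sumrN; apply: eq_bigr => k _.
  by rewrite !mxE mulNr.
have l_dnn : dnn_functional s l.
  split=> [q qs|m1 m2 /multideg_nthP[i ->] /multideg_nthP[j ->]].
    pose w : 'cV[R]_(nmultidegs n s) := \col_k q@_(multideg_nth k).
    have -> : q = \sum_k w k 0 *: 'X_[multideg_nth k].
      by rewrite {1}(multiformE qs); apply: eq_bigr => k _; rewrite mxE.
    rewrite -gram_form_sqr lE oppr_ge0 -[_ *m _]addr0; apply: ip_le0.
      exact: psd_mx_sqr.
    by move=> i j; rewrite mxE.
  rewrite -gram_form_delta lE oppr_ge0 -[delta_mx _ _]add0r; apply: ip_le0.
    exact: psd_mx0.
  by move=> a b; rewrite mxE ler0n.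
have := h_dual l l_dnn; rewrite lE oppr_ge0 => ip_h_le0.
have ip_r_le0 : ip r <= 0.
  have -> : ip r = ip h - ip (gram_form (S + T)).
    rewrite /ip -sumrB; apply: eq_bigr => k _.
    by rewrite -mulrBr -mcoeffB.
  by rewrite subr_le0; apply: le_trans ip_h_le0 ip_ge0.
have r0 : r = 0.
  rewrite /r (multiformE (multiformB hs (multiform_gram_form (S + T)))) -/r.
  apply: big1 => k _.
  have /eqP : ip r = 0.
    apply/eqP; rewrite eq_le ip_r_le0 sumr_ge0 // => j _.
    by rewrite -expr2 sqr_ge0.
  rewrite psumr_eq0 => [/allP/(_ k)|j _]; last by rewrite -expr2 sqr_ge0.
  by rewrite mem_index_enum mulf_eq0 orbb => /(_ isT)/eqP ->; rewrite scale0r.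
apply/SigmaPlusP; exists S, T; split=> //.
by apply/eqP; rewrite -subr_eq0; apply/eqP.
Qed.

End Nearest.

(** * Coefficients of a form multiplied by powers of the sums of the blocks *)

Section PolyaCoefficients.

Variables (R : realType) (p : nat) (n : 'I_p -> nat).
Implicit Types (F G : mvpoly R n) (a b : 'X_{1..nvars n}) (k : 'I_(nvars n)).

Definition block_sum (i : 'I_p) : mvpoly R n := \sum_(j < n i) xvar R n i j.

(** The multi-index factorial [b!]. *)
Definition mfact b : nat := (\prod_k (b k)`!)%N.

(** The multi-index falling factorial, the product of the
[b_k (b_k - 1) ... (b_k - a_k + 1)]. *)
Definition mffact b a : nat := (\prod_k b k ^_ a k)%N.

Lemma mcoeffMXU F k b :
  (F * 'X_k)@_b = if (0 < b k)%N then F@_(b - U_(k)) else 0.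
Proof.
case: ifP => [b_gt0|/negbT b_eq0].
  have {1}-> : b = (U_(k) + (b - U_(k)))%MM.
    by rewrite addmC submK // lep1mP -lt0n.
  by rewrite mcoeffMX.
apply: memN_msupp_eq0; rewrite (perm_mem (msuppMX _ _)).
apply: contra b_eq0 => /mapP[m _ ->].
by rewrite mnmDE mnm1E eqxx.
Qed.

Lemma mfactB b k : (0 < b k)%N -> mfact b = (b k * mfact (b - U_(k))%MM)%N.
Proof.
move=> b_gt0; rewrite /mfact (bigD1 k) //= [in RHS](bigD1 k) //= mulnA; congr (_ * _)%N.
  by rewrite mnmBE mnm1E eqxx subn1 -[in LHS](prednK b_gt0) factS prednK.
by apply: eq_bigr => j ne; rewrite mnmBE mnm1E eq_sym (negbTE ne) subn0.
Qed.

Lemma mffactB b a k : (0 < b k)%N ->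
  (b k * mffact (b - U_(k))%MM a = (b k - a k) * mffact b a)%N.
Proof.
move=> b_gt0; rewrite /mffact (bigD1 k) //= [in RHS](bigD1 k) //= !mulnA.
congr (_ * _)%N.
  rewrite mnmBE mnm1E eqxx subn1 [in RHS]mulnC -ffactnSr.
  by rewrite -[in LHS](prednK b_gt0) /= -ffactSS prednK.
by apply: eq_bigr => j ne; rewrite mnmBE mnm1E eq_sym (negbTE ne) subn0.
Qed.

Lemma mffact_eq0 b a : ~~ (a <= b)%MM -> mffact b a = 0%N.
Proof.
move=> /mnm_lepP nle; have [k lt_k] : exists k, (b k < a k)%N.
  apply/existsP; apply: contra_notT nle; rewrite negb_exists => /forallP ge_k k.
  by rewrite leqNgt ge_k.
by rewrite /mffact (bigD1 k) //= ffact_small.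
Qed.

Lemma mffactnn b : mffact b b = mfact b.
Proof. by apply: eq_bigr => k _; rewrite ffactnn. Qed.

Lemma mfact_gt0 b : (0 < mfact b)%N.
Proof. by apply: prodn_gt0 => k; exact: fact_gt0. Qed.

(** Multiplication by the sum of the block [i] replaces the coefficients [c_b] by
[sum_j c_(b - e_j)], [j] ranging over the block, and
[b_j * mffact (b - e_j) a = (b_j - a_j) * mffact b a].  The sum over the block of the
[b_j - a_j] is a positive integer that depends only on the degrees, and goes into
[w]. *)
Lemma polya_coef_seq (d : 'I_p -> nat) F (l : seq 'I_p) : multiform d F ->
  exists2 w : R, 0 < w & forall b,
    has_multideg (fun i => count_mem i l + d i)%N b ->
    (\prod_(i <- l) block_sum i * F)@_b * (mfact b)%:R =
    w * \sum_(a <- msupp F) F@_a * (mffact b a)%:R.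
Proof.
move=> Fd; elim: l => [|i l [w w_gt0 IH]].
  exists 1 => // b /has_multidegP bd; rewrite big_nil !mul1r.
  (* At equal degrees only a = b satisfies a <= b, and mffact b b = b!. *)
  have mffact0 a : a \in msupp F -> a != b -> mffact b a = 0%N.
    move=> /Fd/has_multidegP ad ne_ab; apply: mffact_eq0; apply: contra ne_ab => le_ab.
    have b_eq : b = (b - a + a)%MM by rewrite submK.
    suff : mdeg (b - a)%MM == 0%N by rewrite mdeg_eq0 => /eqP ba0; rewrite b_eq ba0 add0m.
    rewrite -(eqn_add2r (mdeg a)) -mdegD -b_eq add0n !mdeg_blockdeg.
    by apply/eqP; apply: eq_bigr => i _; rewrite ad bd.
  have [bF|/memN_msupp_eq0 Fb0] := boolP (b \in msupp F).
    rewrite (bigD1_seq b) ?msupp_uniq //= mffactnn [X in _ + X]big_seq_cond.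
    rewrite [X in _ + X]big1 ?addr0 //.
    by move=> a /andP[aF ne_ab]; rewrite mffact0 ?mulr0.
  rewrite Fb0 mul0r [RHS]big_seq [RHS]big1 // => a aF; rewrite mffact0 ?mulr0 //.
  by apply: contraTneq aF => ->; rewrite mcoeff_msupp Fb0 eqxx.
exists (w * (count_mem i l).+1%:R) => [|b b_deg]; first by rewrite mulr_gt0.
have /has_multidegP/(_ i) /= bi := b_deg; rewrite eqxx in bi.
rewrite big_cons -mulrA [block_sum i * _]mulrC {1}/block_sum mulr_sumr raddf_sum mulr_suml.
have stepE (j : 'I_(n i)) :
    (\prod_(i <- l) block_sum i * F * xvar R n i j)@_b * (mfact b)%:R =
    w * \sum_(a <- msupp F) F@_a *
      (((b (tagnat.Rank i j))%:R - (a (tagnat.Rank i j))%:R) * (mffact b a)%:R).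
  set k := tagnat.Rank i j; rewrite mcoeffMXU.
  have subE a : ((b k)%:R - (a k)%:R) * (mffact b a)%:R =
      ((b k - a k) * mffact b a)%:R :> R.
    have [le_ab|nle_ab] := boolP (a <= b)%MM.
      by rewrite natrM natrB //; move/mnm_lepP: le_ab; exact.
    by rewrite mffact_eq0 // muln0 mulr0.
  case: ifP => [b_gt0|/negbT]; last first.
    rewrite -eqn0Ngt => /eqP bk0; rewrite mul0r [X in _ * X]big1 ?mulr0 // => a _.
    by rewrite subE bk0 sub0n mul0n mulr0.
  rewrite (mfactB b_gt0) natrM mulrCA [_ * _%:R]IH.
    rewrite mulrCA; congr (_ * _); rewrite mulr_sumr; apply: eq_bigr => a _.
    by rewrite mulrCA -natrM mffactB // subE.
  apply/has_multidegP => i'; apply/eqP.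
  rewrite -(eqn_add2r (blockdeg (U_(k)%MM : 'X_{1..nvars n}) i')) -blockdegD.
  rewrite submK ?lep1mP -?lt0n // blockdeg1.
  move/has_multidegP: b_deg => ->; rewrite /=; apply/eqP.
  by ring.
rewrite (eq_bigr _ (fun j _ => stepE j)) -mulr_sumr -mulrA; congr (_ * _).
rewrite exchange_big mulr_sumr /= big_seq [RHS]big_seq; apply: eq_bigr => a aF.
rewrite -mulr_sumr -mulr_suml mulrCA; congr (_ * (_ * _)).
have /has_multidegP/(_ i) ai := Fd _ aF.
rewrite sumrB -!natr_sum -!/(blockdeg _ i) ai bi.
by rewrite natrD addrK.
Qed.

Lemma prod_exp_seq (S : comRingType) (M : 'I_p -> nat) :
  exists l : seq 'I_p, (forall i, count_mem i l = M i) /\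
    forall x : 'I_p -> S, \prod_i x i ^+ M i = \prod_(i <- l) x i.
Proof.
exists (flatten [seq nseq (M i) i | i <- enum 'I_p]); split=> [i|x].
  rewrite count_flatten -map_comp sumnE big_map big_enum (bigD1 i) //=.
  rewrite count_nseq /= eqxx mul1n big1 ?addn0 // => j /negbTE ne.
  by rewrite count_nseq /= ne mul0n.
rewrite big_flatten big_map big_enum; apply: eq_bigr => i _.
by rewrite big_nseq -Monoid.iteropE.
Qed.

Lemma polya_coef (d M : 'I_p -> nat) F : multiform d F ->
  exists2 w : R, 0 < w & forall b, has_multideg (fun i => M i + d i)%N b ->
    (\prod_i block_sum i ^+ M i * F)@_b * (mfact b)%:R =
    w * \sum_(a <- msupp F) F@_a * (mffact b a)%:R.
Proof.
move=> Fd; have [l [lM prodE]] := prod_exp_seq (mvpoly R n) M.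
have [w w_gt0 wE] := polya_coef_seq l Fd.
exists w => // b b_deg; rewrite prodE wE //.
by rewrite (eq_has_multideg (t := fun i => (M i + d i)%N)) // => i; rewrite lM.
Qed.

(** The previous lemma for the form [1]. *)
Lemma block_sum_prod_gt0 (M : 'I_p -> nat) b : has_multideg M b ->
  0 < (\prod_i block_sum i ^+ M i)@_b.
Proof.
move=> bM; have [w w_gt0 wE] := polya_coef M (@multiform1 R p n).
have /wE : has_multideg (fun i => M i + 0)%N b.
  by rewrite (eq_has_multideg (t := M)) // => i; rewrite addn0.
rewrite mulr1 -mpolyC1 msupp1 big_seq1 mcoeffC eqxx mulr1 mul1r.
have -> : mffact b 0%MM = 1%N.
  by rewrite /mffact big1 // => k _; rewrite mnm0E ffactn0.
rewrite mulr1 => E; rewrite -(pmulr_lgt0 _ (_ : 0 < (mfact b)%:R)) ?E //.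
by rewrite ltr0n mfact_gt0.
Qed.

Lemma nonneg_coefs_block_sum i : nonneg_coefs (block_sum i).
Proof. by apply: nonneg_coefs_sum => j; exact: nonneg_coefsX. Qed.

End PolyaCoefficients.

(** * Polya's theorem on a product of simplices *)

Lemma ffact_le_expn b a : (b ^_ a <= b ^ a)%N.
Proof.
by elim: a => // a IH; rewrite ffactnSr expnSr leq_mul // leq_subr.
Qed.

(** Both powers count sequences of [a] elements out of [b], with and without
repetitions, and at most [a ^ 2] pairs of positions can collide. *)
Lemma ffact_expB_le (R : realFieldType) (b a : nat) (D : R) : b%:R <= D ->
  (b%:R ^+ a - (b ^_ a)%:R) * D <= (a ^ 2)%:R * D ^+ a.
Proof.
move=> le_bD; have D_ge0 : 0 <= D by apply: le_trans le_bD; rewrite ler0n.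
elim: a => [|a IH]; first by rewrite expr0 ffactn0 subrr !mul0r.
have ge_f : (b%:R - a%:R) * (b ^_ a)%:R <= (b ^_ a.+1)%:R :> R.
  rewrite ffactnSr natrM mulrC ler_wpM2l // lerBlDr -natrD ler_nat.
  by rewrite addnC -leq_subLR.
have f_le : (b ^_ a)%:R <= D ^+ a.
  apply: (@le_trans _ _ (b%:R ^+ a)); last by rewrite lerXn2r ?nnegrE.
  by rewrite -natrX ler_nat ffact_le_expn.
have step : (b%:R ^+ a.+1 - (b ^_ a.+1)%:R) * D <=
    b%:R * ((b%:R ^+ a - (b ^_ a)%:R) * D) + a%:R * ((b ^_ a)%:R * D).
  rewrite exprS; apply: (@le_trans _ _
    ((b%:R * b%:R ^+ a - (b%:R - a%:R) * (b ^_ a)%:R) * D)).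
    by rewrite ler_wpM2r // lerD2l lerN2.
  by rewrite le_eqVlt; apply/orP; left; apply/eqP; ring.
apply: le_trans step _.
have le1 : b%:R * ((b%:R ^+ a - (b ^_ a)%:R) * D) <= D * ((a ^ 2)%:R * D ^+ a).
  apply: (@le_trans _ _ (b%:R * ((a ^ 2)%:R * D ^+ a))); first by rewrite ler_wpM2l.
  by rewrite ler_wpM2r // mulr_ge0 // exprn_ge0.
have le2 : a%:R * ((b ^_ a)%:R * D) <= a%:R * (D ^+ a * D).
  by rewrite ler_wpM2l // ler_wpM2r.
apply: le_trans (lerD le1 le2) _.
have DX_ge0 : 0 <= D * D ^+ a by rewrite mulr_ge0 // exprn_ge0.
have a_ge0 : 0 <= a%:R :> R by [].
rewrite exprS !natrX -natr1; nra.
Qed.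

Lemma prod_dist_le (R : realFieldType) (I : Type) (r : seq I) (x y : I -> R) :
  (forall i, 0 <= x i <= 1) -> (forall i, 0 <= y i <= 1) ->
  `|\prod_(i <- r) x i - \prod_(i <- r) y i| <= \sum_(i <- r) `|x i - y i|.
Proof.
move=> x01 y01; elim: r => [|i r IH]; first by rewrite !big_nil subrr normr0.
rewrite !big_cons.
have -> : x i * \prod_(j <- r) x j - y i * \prod_(j <- r) y j =
    (x i - y i) * \prod_(j <- r) x j + y i * (\prod_(j <- r) x j - \prod_(j <- r) y j).
  ring.
apply: le_trans (ler_normD _ _) _; rewrite !normrM lerD //.
  rewrite ler_piMr // normr_prod; apply: prodr_ile1 => j _.
  by case/andP: (x01 j) => ? ?; rewrite normr_ge0 ger0_norm.
by apply: le_trans IH; rewrite ler_piMl // ger0_norm; case/andP: (y01 i).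
Qed.

Lemma prod_block_const (R : realType) (p : nat) (n : 'I_p -> nat) (c : 'I_p -> R)
    (d : 'I_p -> nat) (m : 'X_{1..nvars n}) : has_multideg d m ->
  \prod_k c (tagnat.sig1 k) ^+ m k = \prod_i c i ^+ d i.
Proof.
move=> /has_multidegP md; rewrite prod_blocks; apply: eq_bigr => i _.
rewrite -md -prodrXr; apply: eq_bigr => j _.
by rewrite tagnat.Rank1K.
Qed.

Section PolyaPositivity.

Variables (R : realType) (p : nat) (n : 'I_p -> nat).
Implicit Types (F : mvpoly R n) (a b : 'X_{1..nvars n}).

(** The degree in the block of [k] of a form of multidegree [M + d]. *)
Definition block_total (M : nat) (d : 'I_p -> nat) (k : 'I_(nvars n)) : R :=
  (M + d (tagnat.sig1 k))%:R.

(** Dividing [b] by its block degrees gives a point of the product of simplices.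
The bound is uniform in [b]: the falling factorials of [b], rescaled, approach the
powers of that point as [M] grows. *)
Lemma mffact_dist_le (M : nat) (d : 'I_p -> nat) a b : (0 < M)%N ->
  has_multideg (fun i => M + d i)%N b ->
  `|(mffact b a)%:R / \prod_k block_total M d k ^+ a k -
    \prod_k ((b k)%:R / block_total M d k) ^+ a k| <=
  (\sum_k a k ^ 2)%:R / M%:R.
Proof.
move=> M_gt0 /has_multidegP b_deg; set D := block_total M d.
have D_gt0 k : 0 < D k by rewrite ltr0n addn_gt0 M_gt0.
have b_le k : (b k)%:R <= D k.
  rewrite ler_nat -b_deg -{1}(tagnat.sig2K k) /blockdeg.
  by rewrite (bigD1 (tagnat.sig2 k)) //= leq_addr.
have M_le k : M%:R <= D k by rewrite ler_nat leq_addr.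
rewrite /mffact natr_prod -prodf_div.
have f_le k : 0 <= (b k)%:R ^+ a k - (b k ^_ a k)%:R :> R.
  by rewrite subr_ge0 -natrX ler_nat ffact_le_expn.
have ff k : (b k)%:R ^+ a k <= D k ^+ a k by rewrite lerXn2r ?nnegrE // ltW.
apply: le_trans (prod_dist_le _ _ _) _ => [k|k|].
- rewrite divr_ge0 ?exprn_ge0 ?(ltW (D_gt0 k)) //= ler_pdivrMr ?exprn_gt0 // mul1r.
  by have := f_le k; have := ff k; lra.
- rewrite exprn_ge0 ?divr_ge0 ?(ltW (D_gt0 k)) //= exprn_ile1 ?divr_ge0 ?(ltW (D_gt0 k)) //.
  by rewrite ler_pdivrMr // mul1r.
rewrite natr_sum mulr_suml; apply: ler_sum => k _.
have DX_ge0 : 0 <= (D k ^+ a k)^-1 by rewrite invr_ge0 exprn_ge0 // ltW.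
rewrite expr_div_n -mulrBl normrM distrC (ger0_norm (f_le k)) (ger0_norm DX_ge0).
apply: (@le_trans _ _ ((a k ^ 2)%:R / D k)).
  rewrite ler_pdivrMr ?exprn_gt0 // mulrAC ler_pdivlMr //.
  exact: ffact_expB_le.
apply: ler_wpM2l => //; rewrite lef_pV2 ?M_le // posrE; first exact: D_gt0.
by rewrite ltr0n.
Qed.

(** The coefficient at [b], of multidegree [M + d], is a positive multiple of a
number that differs by at most [C / M] from the value of [F] at a point of the
product of simplices. *)
Lemma polya (d : 'I_p -> nat) F (c : R) : multiform d F -> 0 < c ->
  (forall v : 'I_(nvars n) -> R, (forall k, 0 <= v k) ->
     (forall i, \sum_(j < n i) v (tagnat.Rank i j) = 1) -> c <= F.@[v]) ->
  exists M0 : nat, forall M, (M0 <= M)%N ->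
    nonneg_coefs (\prod_i block_sum R n i ^+ M * F).
Proof.
move=> Fd c_gt0 F_ge.
pose C : R := \sum_(a <- msupp F) `|F@_a| * (\sum_k a k ^ 2)%:R.
have C_ge0 : 0 <= C by apply: sumr_ge0 => a _; rewrite mulr_ge0.
exists (Num.bound (C / c)).+1 => M le_M b.
have M_gt0 : (0 < M)%N by apply: leq_trans le_M.
have [w w_gt0 wE] := polya_coef (fun=> M) Fd.
have [b_deg|] := boolP (has_multideg (fun i => M + d i)%N b); last first.
  have : multiform (fun i => M + d i)%N (\prod_i block_sum R n i ^+ M * F).
    by apply: multiformM => //; exact: (multiform_linear_blocks (s := fun=> M)).
  by move/multiformP => PFd /PFd ->.
have fact_gt0 : 0 < (mfact b)%:R :> R by rewrite ltr0n mfact_gt0.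
rewrite -(pmulr_lge0 _ fact_gt0) wE // pmulr_rge0 //.
pose D := block_total M d.
have D_gt0 k : 0 < D k by rewrite ltr0n addn_gt0 M_gt0.
pose E : R := \prod_i (M + d i)%:R ^+ d i.
have E_gt0 : 0 < E by apply: prodr_gt0 => i _; rewrite exprn_gt0 // ltr0n addn_gt0 M_gt0.
have DE a : a \in msupp F -> \prod_k D k ^+ a k = E.
  by move=> /Fd; exact: (prod_block_const (fun i => (M + d i)%:R)).
rewrite -(pmulr_lge0 _ (_ : 0 < E^-1)) ?invr_gt0 // mulr_suml.
pose v k := (b k)%:R / D k.
have v_sum i : \sum_(j < n i) v (tagnat.Rank i j) = 1.
  have -> : \sum_(j < n i) v (tagnat.Rank i j) =
      \sum_(j < n i) (b (tagnat.Rank i j))%:R / (M + d i)%:R.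
    by apply: eq_bigr => j _; rewrite /v /D /block_total tagnat.Rank1K.
  rewrite -mulr_suml -natr_sum -/(blockdeg b i) (has_multidegP _ _ b_deg) divff //.
  by rewrite pnatr_eq0 -lt0n addn_gt0 M_gt0.
have v_ge0 k : 0 <= v k by rewrite divr_ge0 // ltW.
have Fv := F_ge v v_ge0 v_sum.
suff dist_le : `|\sum_(a <- msupp F) F@_a * (mffact b a)%:R / E - F.@[v]| <= C / M%:R.
  have CM : C / M%:R <= c.
    rewrite ler_pdivrMr ?ltr0n // -ler_pdivrMl // mulrC.
    have := Num.Theory.archi_boundP (divr_ge0 C_ge0 (ltW c_gt0)).
    move=> /ltW /le_trans; apply; rewrite ler_nat; exact: ltnW.
  move: dist_le; rewrite ler_norml => /andP[+ _]; lra.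
rewrite mevalE -sumrB; apply: le_trans (ler_norm_sum _ _ _) _.
rewrite /C mulr_suml big_seq [leRHS]big_seq; apply: ler_sum => a aF.
rewrite -mulrA -mulrBr normrM -mulrA ler_wpM2l // -(DE a aF).
exact: mffact_dist_le b_deg.
Qed.

End PolyaPositivity.

(** * The minimum over the nonnegative points with unit blocks *)

Lemma is_minimum_inf (R : realType) (A : set R) v : is_minimum A v -> inf A = v.
Proof.
move=> [Av v_lb]; apply/eqP; rewrite eq_le; apply/andP; split.
  by apply: ge_inf => //; exists v.
by apply: lb_le_inf => //; exists v.
Qed.

Section Values.

Variables (R : realType) (p : nat) (n : 'I_p -> nat).
Implicit Types (f g h : mvpoly R n) (v : 'I_(nvars n) -> R).

Definition block_pt (x : forall i, 'cV[R]_(n i)) : 'I_(nvars n) -> R :=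
  fun k => x (tagnat.sig1 k) (tagnat.sig2 k) 0.

Definition pt_blocks v : forall i, 'cV[R]_(n i) :=
  fun i => \col_j v (tagnat.Rank i j).

Lemma pt_blocksK v : block_pt (pt_blocks v) = v.
Proof. by apply: funext => k; rewrite /block_pt mxE tagnat.sig2K. Qed.

(** Multi-homogeneity. *)
Lemma meval_scale_blocks d f (c : 'I_p -> R) v : multiform d f ->
  f.@[fun k => c (tagnat.sig1 k) * v k] = \prod_i c i ^+ d i * f.@[v].
Proof.
move=> fd; rewrite !mevalE mulr_sumr big_seq [RHS]big_seq; apply: eq_bigr => m mf.
rewrite mulrCA; congr (_ * _); rewrite -(prod_block_const c (fd m mf)) -big_split.
by apply: eq_bigr => k _; rewrite exprMn.
Qed.

Definition block_sqr v i : R := \sum_(j < n i) v (tagnat.Rank i j) ^+ 2.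

Lemma meval_gpoly tau v : (gpoly R n tau).@[v] = \prod_i block_sqr v i ^+ tau i.
Proof.
rewrite rmorph_prod; apply: eq_bigr => i _; rewrite rmorphXn raddf_sum /=; congr (_ ^+ _).
by apply: eq_bigr => j _; rewrite rmorphXn /= mevalXU.
Qed.

Lemma meval_block_sum v i :
  (block_sum R n i).@[v] = \sum_(j < n i) v (tagnat.Rank i j).
Proof. by rewrite raddf_sum; apply: eq_bigr => j _; rewrite /= mevalXU. Qed.

Definition unit_pt v := (forall k, 0 <= v k) /\ (forall i, block_sqr v i = 1).

(** Nonzero blocks are divided by their norms; a zero block is a multiple of any
block, here of the first unit vector. *)
Lemma normalize_blocks v : (forall i, 0 < n i)%N -> (forall k, 0 <= v k) ->
  exists2 w, unit_pt w & v = (fun k => Num.sqrt (block_sqr v (tagnat.sig1 k)) * w k).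
Proof.
move=> n_gt0 v_ge0; pose c i := Num.sqrt (block_sqr v i).
have sqr_v_ge0 i : 0 <= block_sqr v i by apply: sumr_ge0 => j _; rewrite sqr_ge0.
have c2 i : c i ^+ 2 = block_sqr v i by rewrite sqr_sqrtr.
pose e (k : 'I_(nvars n)) : R := (tagnat.sig2 k == 0%N :> nat)%:R.
have eE i (j : 'I_(n i)) : e (tagnat.Rank i j) = (j == 0%N :> nat)%:R.
  pose a (u : {i : 'I_p & 'I_(n i)}) : R := (tagged u == 0%N :> nat)%:R.
  by rewrite -[LHS]/(a (tagnat.sig _)) tagnat.rankK.
pose w k := if c (tagnat.sig1 k) == 0 then e k else v k / c (tagnat.sig1 k).
exists w; first split=> [k|i].
- by rewrite /w; case: ifP => // _; rewrite divr_ge0 // sqrtr_ge0.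
- have wE j : w (tagnat.Rank i j) =
      if c i == 0 then e (tagnat.Rank i j) else v (tagnat.Rank i j) / c i.
    by rewrite /w tagnat.Rank1K.
  rewrite /block_sqr (eq_bigr _ (fun j _ => congr1 (fun z => z ^+ 2) (wE j))).
  case: eqVneq => [_|nz].
    rewrite (bigD1 (Ordinal (n_gt0 i))) //= eE /= expr1n big1 ?addr0 // => j ne.
    by rewrite eE -[j == 0%N :> nat]/(j == Ordinal (n_gt0 i)) (negbTE ne) expr0n.
  under eq_bigr do rewrite expr_div_n.
  by rewrite -mulr_suml -/(block_sqr v i) -c2 divff // expf_eq0.
apply: funext => k; rewrite /w -/(c _); case: eqVneq => [c0|nz]; last by rewrite mulrC divfK.
rewrite c0 mul0r; apply/eqP; rewrite -sqrf_eq0.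
have := c2 (tagnat.sig1 k); rewrite c0 expr0n /= => /esym/eqP.
rewrite psumr_eq0 => [/allP/(_ (tagnat.sig2 k))|j _]; last by rewrite sqr_ge0.
by rewrite mem_index_enum tagnat.sig2K; exact.
Qed.

(** The minimum over the compact set of points with unit blocks bounds [f] below
by a multiple of [g], by homogeneity. *)
Lemma unit_minimum tau f : (forall i, 0 < n i)%N -> multiform (twice tau) f ->
  exists2 v, unit_pt v &
    forall w, (forall k, 0 <= w k) -> f.@[v] * (gpoly R n tau).@[w] <= f.@[w].
Proof.
move=> n_gt0 f_form.
pose A := [set z : 'rV[R]_(nvars n) | unit_pt (z 0)].
have toA w : unit_pt w -> A (\row_k w k).
  move=> w_unit; rewrite /A /=.
  by have -> : (\row_k w k) 0 = w :> ('I__ -> R) by apply: funext => k; rewrite mxE.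
have A_neq0 : A !=set0.
  have [k|w w_unit _] := @normalize_blocks (fun=> 0) n_gt0; first by [].
  by exists (\row_k w k); exact: toA.
have A_bounded z : A z -> forall k, `|z 0 k| <= 1.
  move=> [z_ge0 z_unit] k; rewrite ger0_norm // -(@ler_pXn2r _ 2) ?nnegrE //.
  rewrite expr1n -(z_unit (tagnat.sig1 k)) /block_sqr (bigD1 (tagnat.sig2 k)) //=.
  by rewrite tagnat.sig2K lerDl; apply: sumr_ge0 => j _; rewrite sqr_ge0.
have A_closed (z : 'rV[R]_(nvars n)) :
    (forall q : 'rV[R]_(nvars n) -> R, continuous q ->
      (forall w, A w -> 0 <= q w) -> 0 <= q z) -> A z.
  move=> Az; split=> [k|i].
    apply: (Az (fun z => z 0 k)) => [|w [w_ge0 _]//]; exact: coord_continuous.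
  pose sq : mvpoly R n := \sum_(j < n i) 'X_(tagnat.Rank i j) ^+ 2 - 1.
  have sqE (w : 'rV[R]_(nvars n)) : sq.@[w 0] = block_sqr (w 0) i - 1.
    rewrite /sq mevalB meval1 raddf_sum /=; congr (_ - _).
    by apply: eq_bigr => j _; rewrite rmorphXn /= mevalXU.
  have le1 : 0 <= (- sq).@[z 0].
    apply: (Az (fun z => (- sq).@[z 0])) => [|w [_ w_unit]]; first exact: continuous_meval.
    by rewrite mevalN sqE w_unit subrr oppr0.
  have ge1 : 0 <= sq.@[z 0].
    apply: (Az (fun z => sq.@[z 0])) => [|w [_ w_unit]]; first exact: continuous_meval.
    by rewrite sqE w_unit subrr.
  move: le1 ge1; rewrite mevalN sqE oppr_ge0 subr_le0 subr_ge0 => le1 ge1.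
  by apply/eqP; rewrite eq_le le1 ge1.
have [z z_unit z_min] := min_attained A_closed A_bounded A_neq0 (@continuous_meval _ _ f).
exists (z 0) => // w w_ge0.
have [u u_unit wE] := normalize_blocks n_gt0 w_ge0.
have fE : f.@[w] = \prod_i Num.sqrt (block_sqr w i) ^+ twice tau i * f.@[u].
  rewrite {1}wE.
  exact: (meval_scale_blocks (fun i => Num.sqrt (block_sqr w i)) u f_form).
rewrite fE meval_gpoly.
have -> : \prod_i block_sqr w i ^+ tau i =
    \prod_i Num.sqrt (block_sqr w i) ^+ twice tau i.
  apply: eq_bigr => i _; rewrite exprM sqr_sqrtr //.
  by apply: sumr_ge0 => j _; rewrite sqr_ge0.
rewrite mulrC ler_wpM2l //.
  by apply: prodr_ge0 => i _; rewrite exprn_ge0 // sqrtr_ge0.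
have := z_min _ (toA u u_unit).
by have -> : (\row_k u k) 0 = u :> ('I__ -> R) by apply: funext => k; rewrite mxE.
Qed.

Lemma meval_gpoly_unit tau v : unit_pt v -> (gpoly R n tau).@[v] = 1.
Proof.
move=> [_ v_unit]; rewrite meval_gpoly big1 // => i _.
by rewrite v_unit expr1n.
Qed.

Lemma fmin_is_minimum tau f v : unit_pt v ->
  (forall w, (forall k, 0 <= w k) -> f.@[v] * (gpoly R n tau).@[w] <= f.@[w]) ->
  is_minimum (fmin_values tau f) f.@[v].
Proof.
move=> v_unit v_min; split.
  exists (pt_blocks v); last by rewrite /eval_blocks -/(block_pt _) pt_blocksK.
  split=> [|i j k]; last by rewrite mxE; case: v_unit.
  by rewrite -eval_gpoly /eval_blocks -/(block_pt _) pt_blocksK meval_gpoly_unit.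
move=> _ [x [x_unit x_ge0] <-].
rewrite -[leLHS]mulr1 -x_unit -eval_gpoly; apply: v_min => k; exact: x_ge0.
Qed.

End Values.

(** * The doubly nonnegative relaxation *)

Section Moments.

Variables (R : realType) (p : nat) (n : 'I_p -> nat) (tau : 'I_p -> nat).
Implicit Types (f g h : mvpoly R n) (l : {scalar mvpoly R n}).
Implicit Types (y : 'cV[R]_(nmultidegs n (twice tau))).

(** As a polynomial in the squares of the variables, [gpoly] is a product of powers
of sums of blocks, which has positive coefficients. *)
Lemma gpoly_comp : gpoly R n tau =
  (\prod_i block_sum R n i ^+ tau i) \mPo [tuple 'X_k ^+ 2 | k < nvars n].
Proof.
rewrite rmorph_prod; apply: eq_bigr => i _; rewrite rmorphXn raddf_sum /=.
congr (_ ^+ _); apply: eq_bigr => j _.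
by rewrite /xvar comp_mpolyXU -tnth_nth tnth_mktuple.
Qed.

Lemma comp_sqrX (m : 'X_{1..nvars n}) :
  'X_[m] \mPo [tuple 'X_k ^+ 2 | k < nvars n] = 'X_[m + m] :> mvpoly R n.
Proof.
rewrite comp_mpolyX mpolyXD mpolyXE_id -big_split; apply: eq_bigr => k _ /=.
by rewrite tnth_mktuple -expr2 exprAC.
Qed.

Lemma functional_gpoly l : l (gpoly R n tau) =
  \sum_(k < nmultidegs n tau)
    (\prod_i block_sum R n i ^+ tau i)@_(multideg_nth k) *
    l 'X_[multideg_nth k + multideg_nth k].
Proof.
rewrite gpoly_comp {1}(multiformE (multiform_linear_blocks (s := tau))).
rewrite (linear_sum (comp_mpoly _)) (linear_sum l); apply: eq_bigr => k _.
by rewrite /= comp_mpolyZ linearZ /= comp_sqrX.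
Qed.

Lemma dnn_gpoly_ge0 l : dnn_functional tau l -> 0 <= l (gpoly R n tau).
Proof.
move=> [_ l_ge0]; rewrite functional_gpoly; apply: sumr_ge0 => k _.
apply: mulr_ge0; first exact/ltW/block_sum_prod_gt0/multidegs_nth.
by apply: l_ge0; exact: multidegs_nth.
Qed.

(** The square of every monomial of multidegree [tau] occurs in [gpoly] with a
positive coefficient, and the value of [l] at a product of two monomials is at most
the mean of its values at their squares. *)
Lemma dnn_coef_le : exists2 C : R, 0 <= C & forall l m,
  dnn_functional tau l -> has_multideg (twice tau) m ->
  l 'X_[m] <= C * l (gpoly R n tau).
Proof.
pose E := \prod_i block_sum R n i ^+ tau i.
have E_gt0 (k : 'I_(nmultidegs n tau)) : 0 < E@_(multideg_nth k).
  by apply: block_sum_prod_gt0; exact: multidegs_nth.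
exists (\sum_(k < nmultidegs n tau) (E@_(multideg_nth k))^-1) => [|l m l_dnn].
  by apply: sumr_ge0 => k _; rewrite invr_ge0 ltW.
have [l_sqr l_ge0] := l_dnn.
have sqr_le m1 : has_multideg tau m1 -> l 'X_[m1 + m1] <=
    (\sum_(k < nmultidegs n tau) (E@_(multideg_nth k))^-1) * l (gpoly R n tau).
  case/multideg_nthP=> k ->; rewrite mulr_suml (bigD1 k) //=.
  apply: ler_wpDr.
    by apply: sumr_ge0 => j _; rewrite mulr_ge0 ?dnn_gpoly_ge0 // invr_ge0 ltW.
  rewrite mulrC ler_pdivlMr // functional_gpoly (bigD1 k) //= -/E mulrC lerDl.
  apply: sumr_ge0 => j _; rewrite mulr_ge0 ?(ltW (E_gt0 j)) //.
  by apply: l_ge0; exact: multidegs_nth.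
case/halve_multideg => m1 [m2 [-> s1 s2]].
have := l_sqr ('X_[m1] - 'X_[m2]) (multiformB (multiformX s1) (multiformX s2)).
rewrite mulrBl !mulrBr -!mpolyXD !linearB /= [(m2 + m1)%MM]addmC.
have := sqr_le _ s1; have := sqr_le _ s2; lra.
Qed.

Lemma moment_mxE y i j : moment_mx y i j =
  coef_functional y 'X_[multideg_nth i + multideg_nth j].
Proof.
rewrite summxE; apply: eq_bigr => k _.
by rewrite !mxE big_ord1 !mxE mpolyXD.
Qed.

Lemma moment_mx_sqr y (w : 'cV[R]_(nmultidegs n tau)) :
  (w^T *m moment_mx y *m w) 0 0 = coef_functional y (gram_form (w *m w^T)).
Proof.
rewrite -/(bilform _ _ _) bilformE (functional_gram_form (coef_functional y)).
apply: eq_bigr => i _; apply: eq_bigr => j _.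
by rewrite moment_mxE !mxE big_ord1 mxE mulrAC.
Qed.

Lemma dnn_moment_mx y : dnn_functional tau (coef_functional y) <->
  psd_mx (moment_mx y) /\ nonneg_mx (moment_mx y).
Proof.
split=> [[l_sqr l_ge0]|[[_ M_psd] M_ge0]].
  split; last by move=> i j; rewrite moment_mxE; apply: l_ge0; exact: multidegs_nth.
  split=> [|w].
    by apply/matrixP => i j; rewrite mxE !moment_mxE addmC.
  rewrite moment_mx_sqr gram_form_sqr; apply: l_sqr; apply: multiform_sum => i.
  by apply: multiformZ; apply: multiformX; exact: multidegs_nth.
split=> [q qs|m1 m2 /multideg_nthP[i ->] /multideg_nthP[j ->]]; last first.
  by have := M_ge0 i j; rewrite moment_mxE.
pose w : 'cV[R]_(nmultidegs n tau) := \col_k q@_(multideg_nth k).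
have -> : q = \sum_k w k 0 *: 'X_[multideg_nth k].
  by rewrite {1}(multiformE qs); apply: eq_bigr => k _; rewrite mxE.
by rewrite -gram_form_sqr; have := M_psd w; rewrite moment_mx_sqr.
Qed.

Lemma coef_vecE f y : ((coef_vec (twice tau) f)^T *m y) 0 0 = coef_functional y f.
Proof. by rewrite mxE; apply: eq_bigr => k _; rewrite !mxE mulrC. Qed.

Lemma fdnn_valuesE f : fdnn_values tau f =
  [set @coef_functional R p n (twice tau) y f | y in [set y |
     dnn_functional tau (coef_functional y) /\ coef_functional y (gpoly R n tau) = 1]].
Proof.
apply/seteqP; split=> _ [y /= y_in <-].
  case: y_in => M_psd M_ge0 y1; exists y; last by rewrite coef_vecE.
  by rewrite /= -coef_vecE; split=> //; apply/dnn_moment_mx.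
case: y_in => /dnn_moment_mx[M_psd M_ge0] y1; exists y; last by rewrite coef_vecE.
by rewrite /= coef_vecE.
Qed.

Definition moments l : 'cV[R]_(nmultidegs n (twice tau)) :=
  \col_k l 'X_[multideg_nth k].

Lemma coef_functional_moments l f : multiform (twice tau) f ->
  coef_functional (moments l) f = l f.
Proof.
move=> fd; rewrite (functional_multiform l fd).
by apply: eq_bigr => k _; rewrite mxE mulrC.
Qed.

Lemma dnn_moments l :
  dnn_functional tau l -> dnn_functional tau (coef_functional (moments l)).
Proof.
move=> [l_sqr l_ge0]; split=> [q qs|m1 m2 s1 s2].
  rewrite /= coef_functional_moments ?l_sqr //.
  by apply: eq_multiform (multiformM qs qs) => i; rewrite /twice mul2n addnn.
rewrite /= coef_functional_moments ?l_ge0 //; apply: multiformX.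
have := has_multidegD s1 s2; rewrite (eq_has_multideg (t := twice tau)) // => i.
by rewrite /twice mul2n addnn.
Qed.

(** The feasible moments are bounded by [dnn_coef_le], so the feasible set is
compact, and [l0] gives a point of it. *)
Lemma fdnn_attained f l0 : dnn_functional tau l0 -> l0 (gpoly R n tau) = 1 ->
  exists m, is_minimum (fdnn_values tau f) m.
Proof.
move=> l0_dnn l0_g; rewrite fdnn_valuesE.
pose A := [set z : 'rV[R]_(nmultidegs n (twice tau)) |
  dnn_functional tau (coef_functional z^T) /\ coef_functional z^T (gpoly R n tau) = 1].
have lin_z q a (u v : 'rV[R]_(nmultidegs n (twice tau))) :
    coef_functional (a *: u + v)^T q =
    a * coef_functional u^T q + coef_functional v^T q.
  rewrite /coef_functional mulr_sumr -big_split; apply: eq_bigr => k _.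
  by rewrite !mxE mulrDl mulrA.
have z_cont q : continuous (fun z : 'rV[R]_(nmultidegs n (twice tau)) =>
    coef_functional z^T q).
  by apply: continuous_linear_rV => a u v; exact: lin_z.
have A_neq0 : A !=set0.
  exists (moments l0)^T; rewrite /A /= trmxK; split; first exact: dnn_moments.
  by rewrite coef_functional_moments //; exact: multiform_gpoly.
have [C C_ge0 CP] := dnn_coef_le.
have A_bounded z : A z -> forall k, `|z 0 k| <= C.
  move=> [z_dnn z_g] k.
  have zE : z 0 k = coef_functional z^T 'X_[multideg_nth k].
    by rewrite coef_functionalX mxE.
  have k_deg := multidegs_nth k.
  rewrite zE ger0_norm; last exact: (dnn_coef_ge0 z_dnn).
  by have := CP _ _ z_dnn k_deg; rewrite /= z_g mulr1.
have A_closed (z : 'rV[R]_(nmultidegs n (twice tau))) :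
    (forall q : 'rV[R]_(nmultidegs n (twice tau)) -> R, continuous q ->
      (forall w, A w -> 0 <= q w) -> 0 <= q z) -> A z.
  move=> Az; split; first split=> [q qs|m1 m2 s1 s2].
  - by apply: (Az (fun z => coef_functional z^T (q * q))) => // w [[w_sqr _] _]; exact: w_sqr.
  - apply: (Az (fun z => coef_functional z^T 'X_[m1 + m2])) => // w [[_ w_ge0] _].
    exact: w_ge0.
  apply/eqP; rewrite eq_le -subr_ge0 -[X in _ && X]subr_ge0; apply/andP; split.
    apply: (Az (fun z => 1 - coef_functional z^T (gpoly R n tau))) => [w|w [_ ->]].
      by apply: continuousB; [exact: cst_continuous | exact: z_cont].
    by rewrite subrr.
  apply: (Az (fun z => coef_functional z^T (gpoly R n tau) - 1)) => [w|w [_ ->]].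
    by apply: continuousB; [exact: z_cont | exact: cst_continuous].
  by rewrite subrr.
have [z Az z_min] := min_attained A_closed A_bounded A_neq0 (z_cont f).
exists (coef_functional z^T f); split; first by exists z^T.
move=> _ [y y_in <-]; have := z_min y^T; rewrite trmxK; apply.
by rewrite /A /= trmxK.
Qed.

(** If [l g > 0], then [l / l g] is feasible; if [l g = 0], then [l] vanishes on
forms of multidegree [2 tau] by [dnn_coef_le]. *)
Lemma fdnn_le f m l : is_minimum (fdnn_values tau f) m ->
  multiform (twice tau) f -> dnn_functional tau l -> m * l (gpoly R n tau) <= l f.
Proof.
rewrite fdnn_valuesE => -[_ m_lb] fd l_dnn.
have g_ge0 := dnn_gpoly_ge0 l_dnn.
have [C _ CP] := dnn_coef_le.
have gd := @multiform_gpoly R p n tau.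
have [g0|g_neq0] := eqVneq (l (gpoly R n tau)) 0.
  rewrite g0 mulr0 (functional_multiform l fd) big1 // => k _.
  have k_deg := multidegs_nth k.
  have := CP _ _ l_dnn k_deg; have := dnn_coef_ge0 l_dnn k_deg.
  rewrite g0 mulr0 => ge0 le0.
  by have /eqP -> : l 'X_[multideg_nth k] == 0; rewrite ?mulr0 // eq_le le0 ge0.
have g_gt0 : 0 < l (gpoly R n tau) by rewrite lt_def g_neq0.
pose c := (l (gpoly R n tau))^-1; have c_ge0 : 0 <= c by rewrite invr_ge0.
have scaleE q : coef_functional (c *: moments l) q = c * coef_functional (moments l) q.
  rewrite /coef_functional mulr_sumr; apply: eq_bigr => k _.
  by rewrite mxE mulrA.
rewrite -ler_pdivlMr // mulrC -/c -(coef_functional_moments l fd) -scaleE.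
apply: m_lb; exists (c *: moments l) => //; split; last first.
  by rewrite /= scaleE (coef_functional_moments l gd) mulVf.
have [m_sqr m_ge0] := dnn_moments l_dnn.
split=> [q qs|m1 m2 s1 s2]; rewrite /= scaleE mulr_ge0 //.
  exact: m_sqr.
exact: m_ge0.
Qed.

End Moments.

(** * The hierarchy of lower bounds *)

Section Gamma.

Variables (R : realType) (p : nat) (n : 'I_p -> nat) (tau : 'I_p -> nat).
Variables (f : mvpoly R n).
Hypothesis f_form : multiform (twice tau) f.
Implicit Types (eta : 'I_p -> nat) (c : R) (v : 'I_(nvars n) -> R).

Definition sum_prod eta : mvpoly R n := \prod_i block_sum R n i ^+ eta i.

Lemma multiform_sum_prod eta : multiform eta (sum_prod eta).
Proof. exact: (multiform_linear_blocks (s := eta)). Qed.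

Lemma nonneg_coefs_sum_prod eta : nonneg_coefs (sum_prod eta).
Proof.
apply: nonneg_coefs_prod => i; apply: nonneg_coefsXn; exact: nonneg_coefs_block_sum.
Qed.

Lemma sum_prodD eta eta' :
  sum_prod (fun i => eta i + eta' i)%N = sum_prod eta * sum_prod eta'.
Proof. by rewrite -big_split; apply: eq_bigr => i _; rewrite exprD. Qed.

Lemma sum_prod_twice eta : sum_prod (twice eta) = sum_prod eta * sum_prod eta.
Proof. by rewrite -sum_prodD; apply: eq_bigr => i _; rewrite /twice mul2n addnn. Qed.

Let gap c : mvpoly R n := f - c *: gpoly R n tau.

Lemma multiform_gap c : multiform (twice tau) (gap c).
Proof. by apply: multiformB => //; apply: multiformZ; exact: multiform_gpoly. Qed.

Lemma multiform_sum_prod_gap eta c :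
  multiform (twice (fun i => tau i + eta i)%N) (sum_prod (twice eta) * gap c).
Proof.
have := multiformM (@multiform_sum_prod (twice eta)) (@multiform_gap c).
by apply: eq_multiform => i; rewrite /twice mulnDr addnC.
Qed.

(** For each functional, membership of [c] is a linear inequality in [c]. *)
Lemma gamma_valuesP eta c : gamma_values tau eta f c <->
  forall l : {scalar mvpoly R n}, dnn_functional (fun i => tau i + eta i)%N l ->
    c * l (sum_prod (twice eta) * gpoly R n tau) <= l (sum_prod (twice eta) * f).
Proof.
have lE (l : {scalar mvpoly R n}) : l (sum_prod (twice eta) * gap c) =
    l (sum_prod (twice eta) * f) - c * l (sum_prod (twice eta) * gpoly R n tau).
  by rewrite mulrBr -scalerAr linearB linearZ.
split=> [c_in l l_dnn|c_dual].
  by rewrite -subr_ge0 -lE; exact: SigmaPlus_dnn l_dnn.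
apply: dnn_SigmaPlus => [|l l_dnn]; first exact: multiform_sum_prod_gap.
by rewrite -[X in 0 <= l X]/(sum_prod (twice eta) * gap c) lE subr_ge0 c_dual.
Qed.

Lemma gamma_values_le eta eta' c : (forall i, eta i <= eta' i)%N ->
  gamma_values tau eta f c -> gamma_values tau eta' f c.
Proof.
move=> le_eta /gamma_valuesP c_dual; apply/gamma_valuesP => l l_dnn.
pose delta i := (eta' i - eta i)%N.
have etaE : eta' = (fun i => delta i + eta i)%N.
  by apply: funext => i; rewrite subnK.
have dnn_delta : dnn_functional (fun i => tau i + eta i)%N
    (mul_functional (sum_prod delta * sum_prod delta) l).
  apply: (dnn_mul_functional (t := delta)).
  - have -> : (fun i => delta i + (tau i + eta i))%N = (fun i => tau i + eta' i)%N.
      by apply: funext => i; rewrite etaE addnCA.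
    exact: l_dnn.
  - exact: multiform_sum_prod.
  - exact: nonneg_coefs_sum_prod.
have prodE : sum_prod (twice eta') =
    sum_prod delta * sum_prod delta * sum_prod (twice eta).
  by rewrite etaE !sum_prod_twice sum_prodD mulrACA.
have := c_dual _ dnn_delta; rewrite /= /mul_functional.
by rewrite !(mulrA (sum_prod delta * _)) -prodE.
Qed.

Lemma fdnn_gamma eta m : is_minimum (fdnn_values tau f) m -> gamma_values tau eta f m.
Proof.
move=> m_min; apply/gamma_valuesP => l l_dnn; rewrite sum_prod_twice.
pose l' : {scalar mvpoly R n} := mul_functional (sum_prod eta * sum_prod eta) l.
apply: (fdnn_le (l := l') m_min f_form); apply: (dnn_mul_functional (t := eta)).
- have -> : (fun i => eta i + tau i)%N = (fun i => tau i + eta i)%N.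
    by apply: funext => i; rewrite addnC.
  exact: l_dnn.
- exact: multiform_sum_prod.
- exact: nonneg_coefs_sum_prod.
Qed.

(** Evaluation at a point with unit blocks; the sums of its blocks are positive, as
its blocks are nonnegative and not zero. *)
Lemma gamma_values_ub eta v : unit_pt v -> ubound (gamma_values tau eta f) f.@[v].
Proof.
move=> v_unit c /gamma_valuesP/(_ (meval v)); have [v_ge0 v_sqr] := v_unit.
move=> /(_ (dnn_meval _ v_ge0)) /=; rewrite !mevalM meval_gpoly_unit // mulr1 mulrC.
rewrite ler_pM2l // rmorph_prod prodr_gt0 // => i _.
rewrite rmorphXn exprn_gt0 //= meval_block_sum lt_def sumr_ge0 // andbT.
apply/negP => /eqP sum0; have /eqP := v_sqr i; rewrite /block_sqr big1 => [|j _].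
  by rewrite eq_sym oner_eq0.
have /eqP := sum0; rewrite psumr_eq0 // => /allP/(_ j).
by rewrite mem_index_enum => /(_ isT)/eqP ->; rewrite expr0n.
Qed.

(** Linear inequalities pass to the supremum. *)
Lemma gamma_is_maximum eta m v : is_minimum (fdnn_values tau f) m -> unit_pt v ->
  is_maximum (gamma_values tau eta f) (gamma_opt tau eta f).
Proof.
move=> m_min v_unit; rewrite /gamma_opt; set A := gamma_values tau eta f.
have A_sup : has_sup A.
  split; first by exists m; exact: fdnn_gamma.
  by exists f.@[v]; exact: gamma_values_ub.
split; last exact: sup_upper_bound.
apply/gamma_valuesP => l l_dnn.
set b := l _; set a := l _.
have c_le c : A c -> c * b <= a by move=> /gamma_valuesP; exact.
have Am : A m by exact: fdnn_gamma.
have [b_le0|b_gt0] := leP b 0.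
  apply: le_trans (c_le m Am); rewrite ler_wnM2r //.
  exact: sup_upper_bound.
rewrite -ler_pdivlMr //; apply: ge_sup; first by exists m.
by move=> c /c_le; rewrite ler_pdivlMr.
Qed.

(** On the product of simplices [f - c g >= (m - c) g], and [g] is bounded below
there, since [sum_j v_j = 1] over [n] indices implies [sum_j v_j ^ 2 >= 1 / n]. *)
Lemma polya_gamma m c : (forall i, 0 < n i)%N -> c < m ->
  (forall v, (forall k, 0 <= v k) -> m * (gpoly R n tau).@[v] <= f.@[v]) ->
  exists K : nat, gamma_values tau (fun=> K) f c.
Proof.
move=> n_gt0 lt_cm m_lb.
pose e : R := (m - c) * \prod_i (n i)%:R^-1 ^+ tau i.
have e_gt0 : 0 < e.
  rewrite mulr_gt0 ?subr_gt0 // prodr_gt0 // => i _.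
  by rewrite exprn_gt0 // invr_gt0 ltr0n.
have [|K KP] := polya (@multiform_gap c) e_gt0.
  move=> v v_ge0 v_sum; rewrite mevalB mevalZ.
  apply: (@le_trans _ _ ((m - c) * (gpoly R n tau).@[v])); last first.
    by rewrite mulrBl lerD2r m_lb.
  apply: ler_wpM2l; first by rewrite subr_ge0 ltW.
  rewrite meval_gpoly; apply: ler_prod => i _.
  rewrite exprn_ge0 ?invr_ge0 ?ler0n //= lerXn2r ?nnegrE ?invr_ge0 ?ler0n //.
    by apply: sumr_ge0 => j _; rewrite sqr_ge0.
  have n_neq0 : (n i)%:R != 0 :> R by rewrite pnatr_eq0 -lt0n.
  (* The sum of the squared deviations from the mean 1 / n. *)
  have : 0 <= \sum_(j < n i) (v (tagnat.Rank i j) - (n i)%:R^-1) ^+ 2.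
    by apply: sumr_ge0 => j _; rewrite sqr_ge0.
  have -> : \sum_(j < n i) (v (tagnat.Rank i j) - (n i)%:R^-1) ^+ 2 =
      block_sqr v i - (n i)%:R^-1.
    have -> : \sum_(j < n i) (v (tagnat.Rank i j) - (n i)%:R^-1) ^+ 2 =
        \sum_(j < n i) (v (tagnat.Rank i j) ^+ 2 +
          (- (2 * (n i)%:R^-1) * v (tagnat.Rank i j) + (n i)%:R^-1 ^+ 2)).
      by apply: eq_bigr => j _; ring.
    rewrite !big_split /= -mulr_sumr v_sum sumr_const card_ord -mulr_natl.
    by rewrite /block_sqr; field.
  by rewrite subr_ge0.
exists K; apply: dnn_SigmaPlus => [|l l_dnn]; first exact: multiform_sum_prod_gap.
apply: (dnn_nonneg_coefs l_dnn); first exact: multiform_sum_prod_gap.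
have := KP (2 * K)%N; rewrite leq_pmull // => /(_ isT); exact.
Qed.

End Gamma.

Theorem proposition3p5 (R : realType) (p : nat) (n : 'I_p -> nat)
    (tau : 'I_p -> nat) (f : mvpoly R n)
    (p_gt0 : (0 < p)%N) (n_gt0 : forall i : 'I_p, (0 < n i)%N)
    (f_form : multiform (twice tau) f) :
  [/\ is_minimum (fmin_values tau f) (f_min tau f),
      is_minimum (fdnn_values tau f) (f_dnn tau f) &
      forall eta : 'I_p -> nat,
        is_maximum (gamma_values tau eta f) (gamma_opt tau eta f)] /\
  [/\ forall eta : 'I_p -> nat,
        f_dnn tau f <= gamma_opt tau eta f <= f_min tau f,
      forall eta eta' : 'I_p -> nat,
        (forall i : 'I_p, (eta i <= eta' i)%N) ->
        gamma_opt tau eta f <= gamma_opt tau eta' f &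
      forall eps : R, 0 < eps ->
        exists K : nat, forall eta : 'I_p -> nat,
          (forall i : 'I_p, (K <= eta i)%N) ->
          `|gamma_opt tau eta f - f_min tau f| < eps].
Proof.
have [v v_unit v_min] := unit_minimum n_gt0 f_form.
have fmin := fmin_is_minimum v_unit v_min.
have fminE : f_min tau f = f.@[v] := is_minimum_inf fmin.
have [m m_min] := fdnn_attained f (dnn_meval tau v_unit.1) (meval_gpoly_unit tau v_unit).
have fdnnE : f_dnn tau f = m := is_minimum_inf m_min.
have gamma eta := gamma_is_maximum f_form eta m_min v_unit.
have gamma_ub eta : gamma_opt tau eta f <= f.@[v].
  by apply: (gamma_values_ub f_form v_unit (eta := eta)); exact: (gamma eta).1.
split; first by rewrite fminE fdnnE.
split=> [eta|eta eta' le_eta|eps eps_gt0].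
- rewrite fminE fdnnE gamma_ub andbT; apply: (gamma eta).2; exact: fdnn_gamma.
- by apply: (gamma eta').2; apply: gamma_values_le le_eta (gamma eta).1.
have [|K KP] := polya_gamma f_form (c := f.@[v] - eps / 2) n_gt0 _ v_min.
  by rewrite ltrBlDr ltrDl divr_gt0.
exists K => eta le_eta; have := gamma_ub eta.
have := (gamma eta).2 _ (gamma_values_le f_form le_eta KP).
by rewrite fminE ltr_norml => le1 le2; apply/andP; split; lra.
Qed.
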